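(* Let $p\in(0,1]$, $s\in[p,2]$, $P=\lfloor p^{-1}-1\rfloor$, and let $X\subset\mathbb{R}$ be an open interval (possibly unbounded) with $(0,c)\subset X$ for some $c>0$. Let $\{\varphi_k\}_{k\in\mathbb{N}}$ be an orthonormal basis of $L^2(X)$ with $\varphi_k\in\Lambda_{\frac1p-1}(X)$ for every $k$. For $r\in(0,1)$ let $R_rf=\sum_{k\in\mathbb{N}}r^k\langle f,\varphi_k\rangle\varphi_k$, and assume that $R_r$ is an integral operator, $R_rf(y)=\int_XR_r(x,y)f(x)\,dx$, whose kernel is of class $\mathcal{C}^P(X)$ in $x$ for every $y\in X$, and that there exist $\gamma>0$ and a finite set $\Delta$ of positive numbers, each strictly greater than $p^{-1}-1-P$, such that for each $k=0,\ldots,P$ there is a constant $C_k$ with $$\Big\|R_r(x,\cdot)-\sum_{i=0}^k\frac{\partial_x^iR_r(x',\cdot)}{i!}(x-x')^i\Big\|_{L^2(X)}\le C_k\sum_{\delta\in\Delta}(1-r)^{-(1+2k+2\delta)\gamma}|x-x'|^{k+\delta}$$ for all $r\in(0,1)$ and $x,x'\in X$ with $|x-x'|\le1/2$. Assume moreover that there exist $\tau>\frac{4\gamma-2p\gamma-p}{2p}$ and constants $0<m\le M$ such that $$m(k+1)^\tau u^{\frac{1+2\tau-2\gamma}{4\gamma}}\le|\varphi_k(u)|\le M(k+1)^\tau u^{\frac{1+2\tau-2\gamma}{4\gamma}}$$ for all $K\in\mathbb{N}$ with $K\ge1$, all $0\le k\le K$ and all $u\in(0,cK^{-2\gamma})$,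 and that $\varphi_k$ does not change sign on this interval. Set $$E=\frac{(2-p)s\gamma}{p}+\frac{2-s}{2}.$$ Then the exponent $E$ in the inequality $$\sum_{k\in\mathbb{N}}\frac{|\langle f,\varphi_k\rangle|^s}{(k+1)^E}\lesssim\|f\|_{H^p(X)}^s,\qquad f\in H^p(X),$$ cannot be lowered; that is, for every $\varepsilon>0$ there is no constant $C$ such that $\sum_{k\in\mathbb{N}}|\langle f,\varphi_k\rangle|^s(k+1)^{-(E-\varepsilon)}\le C\|f\|^s_{H^p(X)}$ for all $f\in H^p(X)$.
   Context: $\mathbb{N}=\{0,1,2,\ldots\}$. $X$ carries Lebesgue measure. Hardy spaces. For $p\in(0,1]$, $H^p(\mathbb{R})$ is the real Hardy space of distributions $f$ with $\sup_{t>0}|f*\Phi_t|\in L^p(\mathbb{R})$, where $\Phi$ is a fixed Schwartz function with $\int\Phi\ne0$, $\Phi_t(x)=t^{-1}\Phi(x/t)$. For $q\in[1,\infty]$, $q>p$, a $(p,q)$-atom is a measurable function $a$ supported in a bounded interval $B$ with $\|a\|_{L^q}\le|B|^{1/q-1/p}$ and $\int_Ba(x)x^i\,dx=0$ for $0\le i\le\lfloor p^{-1}-1\rfloor$. $H^p(X)$ is the set of all $f=F|_X$ with $F\in H^p(\mathbb{R})$, $\mathrm{supp}\,F\subset\overline X$; each such $f$ can be written $f=\sum_j\lambda_ja_j$ with atoms $a_j$ supported in $X$ and $\sum_j|\lambda_j|^p<\infty$, and $\|f\|_{H^p(X)}=\inf(\sum_j|\lambda_j|^p)^{1/p}$ over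 such decompositions (different $q$ give equivalent quantities). Lipschitz spaces. For $\nu>0$, $\nu\notin\mathbb{N}$, $\Lambda_\nu(\mathbb{R})$ consists of bounded $g\in\mathcal{C}^{\lfloor\nu\rfloor}(\mathbb{R})$ with $\sup_{x,h}|g^{(\lfloor\nu\rfloor)}(x+h)-g^{(\lfloor\nu\rfloor)}(x)|/|h|^{\nu-\lfloor\nu\rfloor}<\infty$; for integer $\nu\ge1$, of bounded $g\in\mathcal{C}^{\nu-1}(\mathbb{R})$ with $\sup_{x,h}|g^{(\nu-1)}(x+h)-2g^{(\nu-1)}(x)+g^{(\nu-1)}(x-h)|/|h|<\infty$ ($h\ne0$); $\Lambda_0(\mathbb{R})=BMO(\mathbb{R})$. $\Lambda_\nu(X)$ is the space of restrictions to $X$ of elements of $\Lambda_\nu(\mathbb{R})$. Pairing. $\langle f,\varphi_k\rangle=\int_Xf\overline{\varphi_k}\,dx$ whenever this makes sense; for general $f\in H^p(X)$ it is the value at $f$ of the bounded linear functional on $H^p(X)$ given by the $H^p$–$\Lambda_{1/p-1}$ duality, i.e. $\sum_j\lambda_j\int_Xa_j\overline{\varphi_k}\,dx$ for an atomic decomposition $f=\sum_j\lambda_ja_j$ with atoms supported in $X$. *)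

(* Defs.v *)
From mathcomp Require Import all_boot all_order all_algebra.
From mathcomp Require Import all_classical all_reals all_analysis.
From mathcomp Require Export complex.

Set Implicit Arguments.
Unset Strict Implicit.
Unset Printing Implicit Defensive.

Import Order.TTheory GRing.Theory Num.Theory.
Import numFieldNormedType.Exports.
Import ComplexField.

Local Open Scope classical_set_scope.
Local Open Scope ring_scope.
Local Open Scope complex_scope.

(** * Complex-valued functions of a real variable

    All operations act on real and imaginary parts; the modulus is
    [normc : R[i] -> R]. *)

Section ComplexValued.
Context {R : realType}.
Implicit Types (f g : R -> R[i]) (D X : set R) (u : nat -> R[i]) (z : R[i]).

Local Notation mu := (@lebesgue_measure R).

Definition ccvg u z := (fun n => Normc.normc (u n - z)) @ \oo --> (0 : R).

Definition cmeasurable D f :=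
  measurable_fun D (fun x => complex.Re (f x)) /\
  measurable_fun D (fun x => complex.Im (f x)).

Definition cintegrable D f :=
  mu.-integrable D (fun x => (complex.Re (f x))%:E) /\
  mu.-integrable D (fun x => (complex.Im (f x))%:E).

Definition cintegral D f : R[i] :=
  (\int[mu]_(x in D) complex.Re (f x)) +i*
  (\int[mu]_(x in D) complex.Im (f x)).

Definition cderive (n : nat) f (x : R) : R[i] :=
  derive1n n (fun y => complex.Re (f y)) x +i*
  derive1n n (fun y => complex.Im (f y)) x.

Definition real_Cn (n : nat) D (h : R -> R) :=
  (forall i, (i < n)%N -> forall x, D x -> derivable (derive1n i h) x 1) /\
  (forall x, D x -> {for x, continuous (derive1n n h)}).

(** Class C^n on the open set [D]: derivatives at a point of [D] only depend on
    the values of the function in [D]. *)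
Definition Cn (n : nat) D f :=
  real_Cn n D (fun x => complex.Re (f x)) /\
  real_Cn n D (fun x => complex.Im (f x)).

Definition LqNorm (q : \bar R) f : \bar R :=
  Lnorm mu q (fun x => (Normc.normc (f x))%:E).

Definition L2norm X f : \bar R :=
  Lnorm mu 2%:E ((fun x => (Normc.normc (f x))%:E) \_ X).

Definition L2 X f := cmeasurable X f /\ (L2norm X f < +oo)%E.

Definition inner X f g : R[i] := cintegral X (fun x => f x * conjc (g x)).

Definition orthonormal_basis X (phi : nat -> R -> R[i]) :=
  [/\ forall k, L2 X (phi k),
      forall j k, inner X (phi j) (phi k) = (j == k)%:R
    & forall f, L2 X f ->
        (fun n => L2norm X
           (fun x => f x - \sum_(0 <= k < n) inner X f (phi k) * phi k x))
          @ \oo --> 0%E].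

(** [kernel] is a kernel of [f |-> \sum_k r^k <f, phi_k> phi_k] on [L^2(X)]:
    for [f] in [L^2(X)], the series converges in [L^2(X)] to
    [y |-> \int_X kernel x y * f x dx]. *)
Definition is_kernel_of X (phi : nat -> R -> R[i]) (r : R)
    (kernel : R -> R -> R[i]) :=
  [/\ measurable_fun (X `*` X) (fun w : R * R => complex.Re (kernel w.1 w.2)),
      measurable_fun (X `*` X) (fun w : R * R => complex.Im (kernel w.1 w.2))
    & forall f, L2 X f ->
        {ae mu, forall y, X y -> cintegrable X (fun x => kernel x y * f x)} /\
        (fun n => L2norm X (fun y =>
           \sum_(0 <= k < n) (r ^+ k)%:C * inner X f (phi k) * phi k y
           - cintegral X (fun x => kernel x y * f x)))
          @ \oo --> 0%E].

End ComplexValued.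

(** * Tempered distributions and the Hardy space *)

Section Hardy.
Context {R : realType}.
Implicit Types (f g phi : R -> R[i]) (X : set R) (F : (R -> R[i]) -> R[i]).

Local Notation mu := (@lebesgue_measure R).

Definition smooth f := forall n, Cn n setT f.

Definition seminorm (i j : nat) f : \bar R :=
  ereal_sup (range (fun x => (`|x| ^+ i * Normc.normc (cderive j f x))%:E)).

Definition schwartz f := smooth f /\ forall i j, (seminorm i j f < +oo)%E.

(** A distribution is a functional of which only the values on Schwartz
    functions are meaningful. *)
Definition tempered F :=
  (forall (z : R[i]) f g, schwartz f -> schwartz g ->
     F (fun x => z * f x + g x) = z * F f + F g) /\
  (exists (C : R) (N : nat), forall f, schwartz f ->
     ((Normc.normc (F f))%:E
        <= C%:E * \sum_(i < N.+1) \sum_(j < N.+1) seminorm i j f)%E).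

Definition fsupp f := closure [set x | f x != 0].

(** [supp F `<=` A], for [A] closed *)
Definition dist_supported (A : set R) F :=
  forall f, smooth f -> compact (fsupp f) -> fsupp f `&` A = set0 -> F f = 0.

Definition dilate f (t x : R) : R[i] := (t^-1)%:C * f (x / t).

(** [sup_(t > 0) |F * Phi_t| (x)]; lower semicontinuous in [x] for tempered
    [F], hence measurable *)
Definition maximal_fun (Phi : R -> R[i]) F (x : R) : \bar R :=
  ereal_sup [set (Normc.normc (F (fun y => dilate Phi t (x - y))))%:E
            | t in [set t : R | 0 < t]].

Definition Hp_line (p : R) Phi F :=
  tempered F /\ (\int[mu]_x (maximal_fun Phi F x `^ p) < +oo)%E.

(** An element [f = F|_X] of [H^p(X)] is represented by [F] itself. For [p < 1]
    there may be non-zero such [F] supported in the boundary of [X] (such as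
    [delta_0 - delta_1] for [X = ]0, 1[] and [1/2 < p < 1]), on which the
    duality pairing below need not vanish: the pairing and atomic
    decompositions have to be understood for [F] on the line. *)
Definition Hp (p : R) Phi X F :=
  Hp_line p Phi F /\ dist_supported (closure X) F.

(** (p,q)-atom; for [q = +oo], [q^-1 = 0] *)
Definition atom (p : R) (q : \bar R) (a : R -> R[i]) :=
  cmeasurable setT a /\
  exists l r : R,
    [/\ l < r,
        forall x, x \notin `[l, r] -> a x = 0,
        (LqNorm q a <= ((r - l) `^ (fine q^-1%E - p^-1))%:E)%E
      & forall i, (i <= Num.truncn (p^-1 - 1)%R)%N ->
          cintegral `[l, r] (fun x => a x * (x ^+ i)%:C) = 0].

(** [F = \sum_j lam_j a_j] in the sense of tempered distributions *)
Definition atomic_decomposition (p : R) (q : \bar R) X F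
    (lam : nat -> R[i]) (a : nat -> R -> R[i]) :=
  [/\ forall j, atom p q (a j),
      forall j x, ~ X x -> a j x = 0,
      (\sum_(0 <= j <oo) (Normc.normc (lam j) `^ p)%:E < +oo)%E
    & forall f, schwartz f ->
        ccvg (fun n =>
          \sum_(0 <= j < n) lam j * cintegral setT (fun x => a j x * f x))
          (F f)].

Definition Hp_norm (p : R) (q : \bar R) X F : \bar R :=
  ereal_inf [set y | exists lam a, atomic_decomposition p q X F lam a /\
    y = ((\sum_(0 <= j <oo) (Normc.normc (lam j) `^ p)%:E) `^ p^-1)%E].

(** [z = <F, phi>], the value of the functional given by the
    H^p--Lambda_(1/p-1) duality; for [phi] in Lambda_(1/p-1)(X) it does not
    depend on the decomposition. *)
Definition is_Hp_pairing (p : R) (q : \bar R) X F phi (z : R[i]) :=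
  exists lam a, atomic_decomposition p q X F lam a /\
    ccvg (fun n => \sum_(0 <= j < n) lam j * inner X (a j) phi) z.

(** ** Lipschitz spaces *)

Definition bounded_on_line g := exists C : R, forall x, Normc.normc (g x) <= C.

Definition BMO g :=
  locally_integrable setT (fun x => complex.Re (g x)) /\
  locally_integrable setT (fun x => complex.Im (g x)) /\
  exists C : R, forall l r : R, l < r ->
    let avg := ((r - l)^-1)%:C * cintegral `[l, r] g in
    \int[mu]_(x in `[l, r]) Normc.normc (g x - avg) <= C * (r - l).

Definition Lip_frac (nu : R) g :=
  let n := Num.truncn nu in
  [/\ bounded_on_line g, Cn n setT g
    & exists C : R, forall x h : R, h != 0 ->
        Normc.normc (cderive n g (x + h) - cderive n g x)
          <= C * `|h| `^ (nu - n%:R)].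

Definition Lip_int (n : nat) g :=
  [/\ bounded_on_line g, Cn n.-1 setT g
    & exists C : R, forall x h : R, h != 0 ->
        Normc.normc (cderive n.-1 g (x + h) - cderive n.-1 g x *+ 2
                     + cderive n.-1 g (x - h)) <= C * `|h|].

Definition Lip (nu : R) g :=
  if nu == 0 then BMO g
  else if nu \is a Num.nat then Lip_int (Num.truncn nu) g
  else Lip_frac nu g.

Definition Lip_on (nu : R) X f :=
  exists2 g, Lip nu g & forall x, X x -> f x = g x.

End Hardy.

(* Main.v *)
Require Import Defs.
From mathcomp Require Import all_boot all_order all_algebra.
From mathcomp Require Import all_classical all_reals all_analysis.
From mathcomp Require Import complex finmap.
From mathcomp Require Import measurable_realfun ess_sup_inf ring lra.

                                                                  
                                                       
                                                                                
                                                                           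
                                                                               
                                                                              
                                                                                
                                                                                
                                                                       
                                                                              
                                                                          
                                                                    

                                                                      
                                                               
                                                                           
                                                                       
                       

Set Implicit Arguments.
Unset Strict Implicit.
Unset Printing Implicit Defensive.

Import Order.TTheory GRing.Theory Num.Theory.
Import numFieldNormedType.Exports.
Import ComplexField.

Local Open Scope classical_set_scope.
Local Open Scope ring_scope.
Local Open Scope complex_scope.

                                            

(** One atom concentrated near 0 pairs well with many [phi k] at once. Put beta = (1 + 2 tau - 2
    gamma) / (4 gamma). Let a be supported in ]0, h], bounded by h^(-1/p), with vanishing moments up
    to order [P]: it is an atom, of H^p norm at most 1. If h < c K^(-2 gamma), every [phi k] with k
    <= K has constant sign on ]0, h] and size comparable to (k+1)^tau u^beta there. Unless the
    cancellation of a spoils it, the pairing is at least a constant times h^(beta + 1 - 1/p)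
    (k+1)^tau for all these k. Taking h = (c/2) K^(-2 gamma) and K = 2n, each term with n <= k < 2n
    of the series of exponent E - eps is at least a constant times n^(eps - 1). The sum is thus at
    least a constant times n^eps, which no bound C survives.

    The point is to reconcile vanishing moments with bounds on |[phi k]| known only up to the
    constants [m] and [M]. Take a proportional to the sum over j of c_j times the indicator of ]0, h
    e^j]. Its moments of order 0, ..., P vanish as soon as Q(x) = sum c_j x^j vanishes at e, ...,
    e^(P+1), so let Q be the product of the factors 1 - x/e^i. Then c_0 = 1, and the steps j >= 1
    contribute, relative to h^(beta+1), at most a constant times the product of the factors 1 +
    e^(beta+1-i), minus 1. Since beta + 1 > 1/p >= P + 1, which is what the lower bound on tau says,
    this is as small as desired for small e, and the step j = 0 dominates whatever M/m is. This is
    carried by [vanishing_step_coefs], [step_integral_lb] and [large_pairing_atoms].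

    That a defines an element of H^p is checked on the maximal function in [functional_of_Hp]: it is
    bounded, and the vanishing moments make it decay like |x|^(-P-2), with (P + 2) p > 1. *)

(** * Coefficients that cancel moments while the first one dominates *)

(** Convexity: on [0, 1] the power lies below its chord. *)
Lemma expr1D_le (R : realFieldType) (n : nat) (t : R) :
  0 <= t <= 1 -> (1 + t) ^+ n <= 1 + t * (2 ^+ n - 1).
Proof.
move=> /andP[t0 t1]; elim: n => [|n IH]; first by rewrite !expr0 subrr mulr0 addr0.
have h2 : 1 <= 2 ^+ n :> R by rewrite exprn_ege1// ler1n.
rewrite exprSr; apply: (le_trans (ler_wpM2r _ IH)); first by rewrite addr_ge0.
rewrite exprSr.
have : t * (t * (2 ^+ n - 1)) <= 1 * (t * (2 ^+ n - 1)).
  by rewrite ler_wpM2r// mulr_ge0// subr_ge0.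
nra.
Qed.

Lemma size_prod_linear_le (R : idomainType) (k : nat -> R) (n : nat) :
  (size (\prod_(i < n) (1 + k i *: 'X : {poly R})%R)%R <= n.+1)%N.
Proof.
rewrite (leq_trans (size_prod_leq _ _))//= card_ord.
rewrite leq_subLR (@leq_trans (\sum_(i < n) 2).+1)//.
  rewrite ltnS; apply: leq_sum => i _.
  rewrite (leq_trans (size_polyD _ _))// geq_max size_poly1/=.
  by rewrite (leq_trans (size_scale_leq _ _))// size_polyX.
by rewrite sum_nat_const card_ord muln2 -addnn addnS.
Qed.

Section GeometricNodes.
Variables (R : realFieldType) (e : R).

                                                                          
                                                                        
(** The roots are e, ..., e^n. The normalisation by 1 at 0, rather than a monic one, makes the
    constant coefficient 1; the coefficients serve as heights of a step function. *)
Definition nodes (n : nat) : {poly R} := \prod_(i < n) (1 - (e ^- i.+1) *: 'X).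

Lemma nodesS n : nodes n.+1 = nodes n - (e ^- n.+1) *: (nodes n * 'X).
Proof. by rewrite /nodes big_ord_recr/= mulrBr mulr1 scalerAr. Qed.

Lemma coef0_nodes n : (nodes n)`_0 = 1.
Proof.
elim: n => [|n IH]; first by rewrite /nodes big_ord0 coef1.
by rewrite nodesS coefB coefZ coefMX/= mulr0 subr0.
Qed.

Lemma horner_nodes n i : e != 0 -> (i < n)%N -> (nodes n).[e ^+ i.+1] = 0.
Proof.
move=> e0 ilt; rewrite /nodes horner_prod (bigD1 (Ordinal ilt))//=.
by rewrite !hornerE mulVf ?expf_neq0// subrr mul0r.
Qed.

Lemma size_nodes_le n : (size (nodes n) <= n.+1)%N.
Proof.
rewrite /nodes; under eq_bigr do rewrite -scaleNr.
exact: (size_prod_linear_le (fun i => - (e ^- i.+1))).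
Qed.

(** Replacing each factor 1 - kX by 1 + kX dominates all coefficients in absolute value, and the
    dominating product is then evaluated at x. *)
Lemma sum_norm_nodes_le n (x : R) : 0 < e -> 0 <= x ->
  \sum_(j < n.+1) `|(nodes n)`_j| * x ^+ j <= \prod_(i < n) (1 + e ^- i.+1 * x).
Proof.
move=> e0 x0.
pose maj m : {poly R} := \prod_(i < m) (1 + (e ^- i.+1) *: 'X).
have majS m : maj m.+1 = maj m + (e ^- m.+1) *: (maj m * 'X).
  by rewrite /maj big_ord_recr/= mulrDr mulr1 scalerAr.
have le_maj m j : `|(nodes m)`_j| <= (maj m)`_j.
  elim: m j => [|m IH] j.
    by rewrite /nodes /maj !big_ord0 coef1; case: eqP => _; rewrite ?normr1 ?normr0.
  rewrite nodesS majS coefB coefD !coefZ !coefMX.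
  apply: (le_trans (ler_normB _ _)); rewrite lerD//.
  rewrite normrM ger0_norm ?invr_ge0 ?exprn_ge0 ?(ltW e0)//.
  rewrite ler_wpM2l ?invr_ge0 ?exprn_ge0 ?(ltW e0)//.
  by case: eqP => // _; rewrite normr0.
have szmaj : (size (maj n) <= n.+1)%N.
  exact: (size_prod_linear_le (fun i => e ^- i.+1)).
have -> : \prod_(i < n) (1 + e ^- i.+1 * x) = (maj n).[x].
  by rewrite /maj horner_prod; apply: eq_bigr => i _; rewrite !hornerE.
rewrite (horner_coef_wide _ szmaj); apply: ler_sum => j _.
by rewrite ler_wpM2r ?exprn_ge0.
Qed.

End GeometricNodes.

(** The coefficients are those of [nodes e n]. At x = e^(beta+1) the majorant is the product of the
    factors 1 + e^(beta+1-i) with 1 <= i <= n, which tends to 1 as e tends to 0 because n < beta +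
    1; removing the term j = 0, equal to 1, leaves a small sum. *)
Lemma vanishing_step_coefs (R : realType) (n : nat) (beta delta : R) :
  n%:R < beta + 1 -> 0 < delta ->
  exists (e : R) (c : nat -> R), [/\ 0 < e < 1, c 0 = 1,
    forall i, (0 < i <= n)%N -> \sum_(j < n.+1) c j * (e ^+ j) ^+ i = 0
  & \sum_(j < n) `|c j.+1| * (e ^+ j.+1) `^ (beta + 1) <= delta].
Proof.
move=> nb d0.
pose t := Num.min 2^-1 (delta / 2 ^+ n).
have t0 : 0 < t by rewrite lt_min invr_gt0 ltr0n/= divr_gt0// exprn_gt0.
have t1 : t <= 2^-1 by rewrite ge_min lexx.
have td : t * 2 ^+ n <= delta.
  by rewrite -ler_pdivlMr ?exprn_gt0// ge_min lexx orbT.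
(* The smallest of the exponents beta + 1 - i with i <= n. The choice of [e] gives e^w = t, so each
   factor of the majorant is at most 1 + t, and (1 + t)^n <= 1 + t 2^n <= 1 + delta. *)
pose w := beta + 1 - n%:R.
have w0 : 0 < w by rewrite subr_gt0.
pose e := t `^ w^-1.
have e0 : 0 < e by rewrite powR_gt0.
have e1 : e < 1.
  have t1' : t < 1 by rewrite (le_lt_trans t1)// invf_lt1 ?ltr0n// ltr1n.
  rewrite /e /powR gt_eqF// -expR0 ltr_expR pmulr_rlt0 ?invr_gt0//.
  by rewrite ln_lt0// t0.
have ew : e `^ w = t by rewrite -powRrM mulVf ?gt_eqF// powRr1// ltW.
exists e, (fun j => (nodes e n)`_j); split.
- by rewrite e0 e1.
- exact: coef0_nodes.
- move=> [//|i] /= ilt.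
  transitivity (nodes e n).[e ^+ i.+1]; last by rewrite horner_nodes ?gt_eqF.
  rewrite (horner_coef_wide _ (size_nodes_le e n)).
  by apply: eq_bigr => j _; rewrite -!exprM mulnC.
set x := e `^ (beta + 1).
have x0 : 0 <= x by rewrite powR_ge0.
have := sum_norm_nodes_le n e0 x0.
rewrite big_ord_recl/= coef0_nodes normr1 expr0 mulr1 -lerBrDl => h.
have xE j : (e ^+ j) `^ (beta + 1) = x ^+ j.
  by rewrite -powR_mulrn ?ltW// -powRrM mulrC powRrM powR_mulrn// powR_ge0.
under eq_bigr do rewrite xE.
apply: (le_trans h).
rewrite lerBlDl (@le_trans _ _ ((1 + t) ^+ n))//; last first.
  apply: le_trans (expr1D_le _ _) _; first by rewrite (ltW t0) (le_trans t1)// invf_le1 ?ltr0n// ler1n.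
  rewrite lerD2l mulrBr mulr1 lerBlDr (le_trans td)// lerDl ltW//.
rewrite -[n in leRHS]card_ord -prodr_const ler_prod// => i _.
rewrite addr_ge0 ?mulr_ge0 ?invr_ge0 ?exprn_ge0 ?(ltW e0)//= lerD2l -ew.
rewrite -powR_mulrn ?(ltW e0)// -powRN -powRD; last by apply/implyP => _; rewrite gt_eqF.
rewrite ger_powR//; first by rewrite e0 ltW.
by rewrite addrC lerD2l lerN2 ler_nat.
Qed.

                       

(** * Step functions on initial intervals and their moments *)

Section StepFunctions.
Context {R : realType}.
Local Notation mu := (@lebesgue_measure R).
Implicit Types (c r : nat -> R) (f : R -> R) (D : set R) (h b : R).

(** The steps are open at 0 because [X] is only known to contain ]0, c[. *)
Definition step (n : nat) c r (x : R) : R :=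
  \sum_(j < n) c j * \1_(`]0, r j]) x.

Lemma measurable_step n c r : measurable_fun setT (step n c r).
Proof.
rewrite /step; apply: measurable_sum => j.
by apply: measurable_funM => //; exact: measurable_indic.
Qed.

Lemma norm_step_le n c r x : `|step n c r x| <= \sum_(j < n) `|c j|.
Proof.
apply: (le_trans (ler_norm_sum _ _ _)); apply: ler_sum => j _.
by rewrite normrM ler_piMr// indicE; case: (_ \in _); rewrite ?normr1 ?normr0.
Qed.

Lemma step_out n c r h x : (forall j, (j < n)%N -> r j <= h) ->
  ~ [set` `]0, h]] x -> step n c r x = 0.
Proof.
move=> rh nx; rewrite /step big1// => j _; rewrite indicE memNset ?mulr0//.
move=> /=; rewrite in_itv/= => /andP[x0 xr]; apply: nx.
by rewrite /= in_itv/= x0 (le_trans xr)// rh.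
Qed.

Lemma Rintegral_indicM D h b f : measurable D -> [set` `]0, h]] `<=` D ->
  b <= h -> mu.-integrable `]0, h] (EFin \o f) ->
  mu.-integrable D (EFin \o (fun x => \1_(`]0, b]) x * f x)) /\
  \int[mu]_(x in D) (\1_(`]0, b]) x * f x) = \int[mu]_(x in `]0, b]) f x.
Proof.
move=> mD hD bh If.
have sub : [set` `]0, b]] `<=` D.
  apply: subset_trans hD => x /=; rewrite !in_itv/= => /andP[-> xb] /=.
  exact: le_trans bh.
have Ib : mu.-integrable `]0, b] (EFin \o f).
  apply: integrableS If => // x /=; rewrite !in_itv/= => /andP[-> xb] /=.
  exact: le_trans bh.
have E : (fun x => \1_(`]0, b]) x * f x) = f \_ `]0, b].
  by apply/funext => x; rewrite patchE indicE; case: (x \in _); rewrite ?mul1r ?mul0r.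
split.
  rewrite E -restrict_EFin; apply/integrable_restrict => //.
  by rewrite (setIidr sub).
by rewrite E -Rintegral_mkcondr (setIidr sub).
Qed.

Lemma Rintegral_step n c r D h f : measurable D -> [set` `]0, h]] `<=` D ->
  (forall j, (j < n)%N -> r j <= h) -> mu.-integrable `]0, h] (EFin \o f) ->
  mu.-integrable D (EFin \o (fun x => step n c r x * f x)) /\
  \int[mu]_(x in D) (step n c r x * f x) =
  \sum_(j < n) c j * \int[mu]_(x in `]0, r j]) f x.
Proof.
move=> mD hD rh If; elim: n rh => [|n IH] rh.
  have -> : (fun x => step 0 c r x * f x) = (fun=> 0).
    by apply/funext => x; rewrite /step big_ord0 mul0r.
  split; first exact: integrable0.
  by rewrite big_ord0 (Rintegral_cst mu mD) mul0r.
have [|I1 E1] := IH; first by move=> j jn; apply: rh; rewrite ltnS ltnW.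
have [I2 E2] := Rintegral_indicM mD hD (rh n (ltnSn n)) If.
have I3 : mu.-integrable D (EFin \o (fun x => c n * (\1_(`]0, r n]) x * f x))).
  by have := @integrableZl _ _ R mu D mD (c n) _ I2; apply: eq_integrable.
have -> : (fun x => step n.+1 c r x * f x) =
    (fun x => step n c r x * f x + c n * (\1_(`]0, r n]) x * f x)).
  by apply/funext => x; rewrite /step big_ord_recr/= mulrDl mulrA.
split; first by have := @integrableD _ _ R mu D mD _ _ I1 I3; apply: eq_integrable.
by rewrite RintegralD// RintegralZl// E1 E2 big_ord_recr.
Qed.

Lemma continuous_integrable_itvoc h f : continuous f ->
  mu.-integrable `]0, h] (EFin \o f).
Proof.
move=> cf; apply: (@integrableS _ _ R mu `[0, h]) => //.
  by move=> x /=; rewrite !in_itv/= => /andP[/ltW -> ->].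
apply: continuous_compact_integrable; first exact: segment_compact.
exact: continuous_subspaceT.
Qed.

Lemma Rintegral_exprn (b : R) i : 0 < b ->
  \int[mu]_(x in `]0, b]) (x ^+ i) = b ^+ i.+1 / i.+1%:R.
Proof.
move=> b0.
have cX : continuous (fun x : R => x ^+ i) by exact: exprn_continuous.
rewrite Rintegral_itv_obnd_cbnd; last exact: continuous_integrable_itvoc.
pose F (x : R) : R := i.+1%:R^-1 * x ^+ i.+1.
have dF (x : R) : is_derive x (1 : R) F (x ^+ i).
  have -> : F = i.+1%:R^-1 *: (id ^+ i.+1 : R -> R).
    by apply/funext => y; rewrite /F /GRing.scale/= exprfctE.
  by apply: is_derive_eq; rewrite /GRing.scale/= mulr1 mulKf.
have cF : continuous F.
  by move=> x; apply/differentiable_continuous/derivable1_diffP; case: (dF x).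
rewrite /Rintegral (@continuous_FTC2 _ _ F)//.
- by rewrite /= /F expr0n/= mulr0 subr0 mulrC.
- exact: continuous_subspaceT.
- split.
  + by move=> x _; case: (dF x).
  + exact/cvg_at_right_filter/cF.
  + exact/cvg_at_left_filter/cF.
- by move=> x _; rewrite derive1E; have [_ ->] := dF x.
Qed.

(** The interval ]0, r_j] contributes r_j^(i+1) / (i+1), so the moment of order i is governed by the
    power sum of exponent i+1. This shift is why orders 0, ..., P call for P+1 nodes. *)
Lemma step_moment n c r D h i : measurable D -> [set` `]0, h]] `<=` D ->
  (forall j, (j < n)%N -> 0 < r j <= h) ->
  \sum_(j < n) c j * r j ^+ i.+1 = 0 ->
  \int[mu]_(x in D) (step n c r x * x ^+ i) = 0.
Proof.
move=> mD hD rh s0.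
have [|//|_ ->] := @Rintegral_step n c r D h (fun x => x ^+ i) mD hD.
- by move=> j /rh /andP[].
- exact/continuous_integrable_itvoc/exprn_continuous.
rewrite (eq_bigr (fun j : 'I_n => (c j * r j ^+ i.+1) * i.+1%:R^-1)).
  by rewrite -mulr_suml s0 mul0r.
by move=> j _; rewrite Rintegral_exprn ?mulrA//; case/andP: (rh _ (ltn_ord j)).
Qed.

End StepFunctions.

              

(** * Bounded functions supported in ]0, h], and the atoms they give *)

Lemma lebesgue_measure_itvoc {R : realType} (h : R) : 0 < h ->
  @lebesgue_measure R [set` `]0, h]] = h%:E.
Proof. by move=> h0; rewrite lebesgue_measure_itv/= lte_fin h0 oppr0 adde0. Qed.

Section BoundedFunctions.
Context {R : realType}.
Local Notation mu := (@lebesgue_measure R).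
Variables (a : R -> R) (h A : R).
Hypotheses (h0 : 0 < h) (ma : measurable_fun setT a)
  (a_out : forall x, ~ [set` `]0, h]] x -> a x = 0)
  (aA : forall x, `|a x| <= A).
Implicit Types (f : R -> R) (D : set R).

Let A0 : 0 <= A. Proof. exact: le_trans (normr_ge0 _) (aA 0). Qed.

Lemma restrict_supp D f : [set` `]0, h]] `<=` D ->
  (fun x => a x * f x) \_ D = (fun x => a x * f x) \_ [set` `]0, h]].
Proof.
move=> hD; apply/funext => x; rewrite !patchE.
case: (pselect ([set` `]0, h]] x)) => hx; first by rewrite !mem_set//; exact: hD.
by rewrite (memNset hx) a_out// mul0r; case: ifP.
Qed.

Lemma Rintegral_supp D f : [set` `]0, h]] `<=` D ->
  \int[mu]_(x in D) (a x * f x) = \int[mu]_(x in `]0, h]) (a x * f x).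
Proof.
by move=> hD; rewrite Rintegral_mkcond [RHS]Rintegral_mkcond restrict_supp.
Qed.

Lemma integrable_suppM f : mu.-integrable `]0, h] (EFin \o f) ->
  mu.-integrable `]0, h] (EFin \o (fun x => a x * f x)).
Proof.
move=> If.
apply: (@le_integrable _ _ R mu _ _ _ (fun x => A%:E * (EFin \o f) x)%E) => //.
- apply/measurable_EFinP; apply: measurable_funM.
    exact: measurable_funTS.
  by apply/measurable_EFinP; case/integrableP: If.
- move=> x _ /=; rewrite lee_fin !normrM.
  by rewrite (ger0_norm A0) ler_wpM2r.
- exact: integrableZl.
Qed.

Lemma integrable_supp D f : measurable D -> [set` `]0, h]] `<=` D ->
  mu.-integrable `]0, h] (EFin \o f) ->
  mu.-integrable D (EFin \o (fun x => a x * f x)).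
Proof.
move=> mD hD /integrable_suppM If.
have [_] := @integrable_mkcond _ _ R mu D (EFin \o (fun x => a x * f x)) mD.
apply.
rewrite restrict_EFin (restrict_supp _ hD) -restrict_EFin.
have [+ _] := @integrable_mkcond _ _ R mu _ (EFin \o (fun x => a x * f x)) (measurable_itv `]0, h]).
exact.
Qed.

Lemma normr_Rintegral_supp_le D f : [set` `]0, h]] `<=` D ->
  mu.-integrable `]0, h] (EFin \o f) ->
  `|\int[mu]_(x in D) (a x * f x)| <= A * \int[mu]_(x in `]0, h]) `|f x|.
Proof.
move=> hD If; rewrite Rintegral_supp//.
have Inf : mu.-integrable `]0, h] (EFin \o (fun x => `|f x|)).
  exact: (@integrable_abse _ _ R mu _ _ If).
apply: (le_trans (le_normr_Rintegral _ (integrable_suppM If))) => //.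
rewrite -RintegralZl//; apply: le_Rintegral => //.
- exact: (@integrable_abse _ _ R mu _ _ (integrable_suppM If)).
- by have := @integrableZl _ _ R mu _ (measurable_itv _) A _ Inf; exact: eq_integrable.
- by move=> x _; rewrite normrM ler_wpM2r.
Qed.

Lemma normr_Rintegral_supp_le_bound D f (B : R) : [set` `]0, h]] `<=` D ->
  mu.-integrable `]0, h] (EFin \o f) ->
  (forall x, 0 < x <= h -> `|f x| <= B) ->
  `|\int[mu]_(x in D) (a x * f x)| <= A * (B * h).
Proof.
move=> hD If fB; apply: (le_trans (normr_Rintegral_supp_le hD If)).
rewrite ler_wpM2l//.
have -> : B * h = \int[mu]_(x in `]0, h]) B.
  rewrite (Rintegral_cst mu)//; congr (_ * _).
  by have /(congr1 fine) := lebesgue_measure_itvoc h0.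
apply: le_Rintegral => //.
- exact: (@integrable_abse _ _ R mu _ _ If).
- exact/continuous_integrable_itvoc/cst_continuous.
Qed.

End BoundedFunctions.

Section Atoms.
Context {R : realType}.
Local Notation mu := (@lebesgue_measure R).

Lemma normc_real (x : R) : Normc.normc x%:C = `|x|.
Proof. by rewrite /Normc.normc /= expr0n addr0 sqrtr_sqr. Qed.

Lemma LqNorm_bounded_le (q : \bar R) (a : R -> R) (h A : R) : (1 <= q)%E ->
  0 < h -> 0 < A -> measurable_fun setT a ->
  (forall x, ~ [set` `]0, h]] x -> a x = 0) -> (forall x, `|a x| <= A) ->
  (LqNorm q (fun x => (a x)%:C) <= (A * h `^ fine q^-1)%:E)%E.
Proof.
move=> q1 h0 A0 ma aout aA; rewrite /LqNorm.
have -> : (fun x => (Normc.normc (a x)%:C)%:E) = EFin \o (fun x => `|a x|).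
  by apply/funext => x; rewrite normc_real.
rewrite unlock; case: q q1 => [r||//]; last first.
  (* For q = +oo the exponent [fine q^-1] is 0 and the claim is the sup bound itself. *)
  move=> _; rewrite invey powRr0 mulr1; case: ifPn => _; last by rewrite lee_fin ltW.
  apply/ess_supP; apply: nearW => x /=.
  by rewrite normr_id lee_fin.
rewrite lee_fin => r1.
have r0 : 0 < r by rewrite (lt_le_trans ltr01).
rewrite inver gt_eqF//=.
have Ar : A * h `^ r^-1 = (A `^ r * h) `^ r^-1.
  by rewrite powRM ?powR_ge0 ?(ltW h0)// -powRrM divff ?gt_eqF// powRr1// ltW.
rewrite Ar -poweR_EFin gt0_ler_poweR//=.
- by rewrite invr_ge0 ltW.
- by rewrite in_itv/= leey integral_ge0// => x _; rewrite poweR_ge0.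
- by rewrite in_itv/= leey andbT lee_fin mulr_ge0 ?powR_ge0// ltW.
have -> : (A `^ r * h)%:E = (\int[mu]_(x in [set` `]0%R, h]%R]) (A `^ r)%:E)%E.
  by rewrite integral_cst// EFinM; congr (_ * _)%E; rewrite -(lebesgue_measure_itvoc h0).
rewrite [leRHS]integral_mkcond.
apply: ge0_le_integral => //.
- rewrite (_ : (fun _ => _) = EFin \o (fun x => `|a x| `^ r)).
    apply/measurable_EFinP.
    apply: (@measurableT_comp _ _ _ _ _ _ (@powR R ^~ r)) => //.
    exact: measurableT_comp.
  by apply/funext => x /=; rewrite normr_id.
- by apply/(measurable_restrictT _ _).1 => //; exact: measurable_cst.
- move=> x _; rewrite patchE /= normr_id.
  case: ifPn => [_|]; first by rewrite lee_fin ge0_ler_powR// ?nnegrE ?(ltW r0)// ltW.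
  by move=> /negP nx; rewrite aout ?normr0 ?powR0 ?gt_eqF// => hx; apply: nx; exact/mem_set.
Qed.

(** The sup bound is the (p, oo) normalisation; on a support of length h it implies the (p, q)
    normalisation for every q >= 1. *)
Lemma bounded_atom (p : R) (q : \bar R) (a : R -> R) (h : R) : (1 <= q)%E ->
  0 < h -> measurable_fun setT a ->
  (forall x, ~ [set` `]0, h]] x -> a x = 0) ->
  (forall x, `|a x| <= h `^ (- p^-1)) ->
  (forall i, (i <= Num.truncn (p^-1 - 1)%R)%N ->
    \int[mu]_(x in `]0, h]) (a x * x ^+ i) = 0) ->
  atom p q (fun x => (a x)%:C).
Proof.
move=> q1 h0 ma aout aA a0.
split; first by split => //=; exact: measurable_cst.
exists 0, h; split => //.
- move=> x; rewrite in_itv/= negb_and => hx; rewrite aout//= in_itv/= => /andP[x0 xh].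
  by move: hx; rewrite xh (ltW x0).
- have := LqNorm_bounded_le q1 h0 (powR_gt0 _ h0) ma aout aA.
  by rewrite subr0 -powRD ?(gt_eqF h0) ?implybT// addrC.
- move=> i /a0 ai; rewrite /cintegral /=.
  under eq_Rintegral do rewrite mulr0 subr0.
  under [X in _ +i* X]eq_Rintegral do rewrite mulr0 mul0r addr0.
  rewrite (Rintegral_supp aout) ?ai; last first.
    by move=> x /=; rewrite !in_itv/= => /andP[/ltW-> ->].
  by rewrite (Rintegral_cst mu)// mul0r.
Qed.

(** The distribution attached to [a]: no conjugation on [f], unlike in [inner]. *)
Definition functional_of (a : R -> R[i]) (f : R -> R[i]) : R[i] :=
  cintegral setT (fun x => a x * f x).

Lemma normc0 : Normc.normc (0 : R[i]) = 0.
Proof. by rewrite /= expr0n addr0 sqrtr0. Qed.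

Lemma normc1 : Normc.normc (1 : R[i]) = 1.
Proof. by rewrite /= expr0n addr0 expr1n sqrtr1. Qed.

(** A single atom as an infinite decomposition: coefficients 1, 0, 0, ... with the constant sequence
    [a]. *)
Let unit_coef (j : nat) : R[i] := (j == 0)%:R.

Let sum_unit_coef (u : nat -> R[i]) n :
  \sum_(0 <= j < n.+1) unit_coef j * u j = u 0.
Proof.
rewrite big_nat_recl// /unit_coef eqxx mul1r big1 ?addr0// => i _.
by rewrite mul0r.
Qed.

Let ccvg_unit_coef (u : nat -> R[i]) :
  ccvg (fun n => \sum_(0 <= j < n) unit_coef j * u j) (u 0).
Proof.
rewrite /ccvg -(cvg_shiftn 1); apply: cvg_near_cst; apply: nearW => n.
by under eq_fun do rewrite addn1 sum_unit_coef subrr normc0.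
Qed.

Let nneseries_unit_coef (p : R) : 0 < p ->
  (\sum_(0 <= j <oo) (Normc.normc (unit_coef j) `^ p)%:E = 1)%E.
Proof.
move=> p0; rewrite (nneseries_split 0 1); last by move=> k _; rewrite lee_fin powR_ge0.
rewrite add0n big_nat1 /unit_coef eqxx normc1 powR1 eseries0 ?adde0//.
by move=> [|k]// _ _; rewrite normc0 powR0 ?gt_eqF.
Qed.

Variables (p : R) (q : \bar R) (X : set R) (a : R -> R[i]).
Hypotheses (p0 : 0 < p) (ata : atom p q a) (aX : forall x, ~ X x -> a x = 0).

Let atomic_decomposition_atom :
  atomic_decomposition p q X (functional_of a) unit_coef (fun=> a).
Proof.
by split => //; rewrite nneseries_unit_coef// ltry.
Qed.

Lemma Hp_norm_atom_le1 : (Hp_norm p q X (functional_of a) <= 1)%E.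
Proof.
apply: ereal_inf_lbound; exists unit_coef, (fun=> a); split => //.
by rewrite nneseries_unit_coef// poweR1r.
Qed.

Lemma Hp_pairing_atom phi :
  is_Hp_pairing p q X (functional_of a) phi (inner X a phi).
Proof.
by exists unit_coef, (fun=> a).
Qed.

End Atoms.

                                                  

(** * Integrability from decay, without measurability *)

Section LowerIntegral.
Context {R : realType}.
Local Notation mu := (@lebesgue_measure R).

                                                                               
                                                                  
(** The integral of a nonnegative function is a supremum over simple functions below it, so
    monotonicity holds for arbitrary functions. It will be applied to the maximal function without
    establishing its measurability. *)
Lemma ge0_le_integralT (g G : R -> \bar R) : (forall x, 0 <= g x)%E ->
  (forall x, g x <= G x)%E -> (\int[mu]_x g x <= \int[mu]_x G x)%E.
Proof.
move=> g0 gG; have G0 x : (0 <= G x)%E := le_trans (g0 x) (gG x).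
rewrite !ge0_integralTE//; apply: ereal_sup_le => _ [f /= fg <-].
by exists f => // x; exact: le_trans (fg x) (gG x).
Qed.

Lemma cvgy_powRN (w : R) : 0 < w -> (1 + x) `^ (- w) @[x --> +oo] --> (0 : R).
Proof.
move=> w0; apply/cvgrPdist_le => /= d d0.
near=> x.
have x0 : 0 < x by near: x; exact: nbhs_pinfty_gt.
rewrite sub0r normrN ger0_norm ?powR_ge0// powRN -[leRHS]invrK lef_pV2 ?posrE; last 2 first.
- by rewrite powR_gt0// addr_gt0.
- by rewrite invr_gt0.
rewrite (@le_trans _ _ (((d^-1) `^ w^-1) `^ w))//.
  by rewrite -powRrM mulVf ?gt_eqF// powRr1// invr_ge0 ltW.
rewrite ge0_ler_powR ?nnegrE ?powR_ge0 ?addr_ge0 ?(ltW w0) ?(ltW x0)//.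
by rewrite (@le_trans _ _ x)// lerDr.
Unshelve. all: by end_near. Qed.

Lemma integral_powRN_lty (al : R) : 1 < al ->
  (\int[mu]_x ((1 + `|x|) `^ (- al))%:E < +oo)%E.
Proof.
move=> al1.
have pos (x : R) : 0 < 1 + `|x| :> R by rewrite (lt_le_trans ltr01)// lerDl.
have dP (b y : R) : 0 < 1 + y ->
    is_derive y (1 : R) (fun x => (1 + x) `^ b) (b * (1 + y) `^ (b - 1)).
  move=> y1.
  have d1 : is_derive y (1 : R) (cst 1 + id : R -> R) 1.
    by apply: is_derive_eq; rewrite add0r.
  have := @is_derive1_comp R (@powR R ^~ b) (cst 1 + id) y _ 1 (is_derive1_powR b y1) d1.
  by rewrite mulr1.
have cP (b y : R) : 0 < 1 + y -> {for y, continuous (fun x : R => (1 + x) `^ b)}.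
  by move=> /(dP b) [dy _]; exact/differentiable_continuous/derivable1_diffP.
rewrite ge0_symfun_integralT//=; last 2 first.
- move=> x; apply: (@continuous_comp _ _ _ (fun x : R => `|x|) (fun x : R => (1 + x) `^ (- al))).
    exact: norm_continuous.
  exact: cP.
- by move=> x /=; rewrite normrN.
have -> : [set x : R | 0 <= x] = [set` `[0, +oo[] by rewrite set_itvcy.
have -> : (\int[mu]_(x in `[0%R, +oo[) ((1 + `|x|) `^ (- al))%:E =
           \int[mu]_(x in `[0%R, +oo[) ((1 + x) `^ (- al))%:E)%E.
  apply: eq_integral => x /set_mem /=; rewrite in_itv/= andbT => x0.
  by rewrite ger0_norm.
(* The primitive of (1 + x)^(-al) that vanishes at +oo; here al > 1 enters. *)
pose F (x : R) : R := - (al - 1)^-1 * (1 + x) `^ (- (al - 1)).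
have dF (y : R) : 0 < 1 + y -> is_derive y (1 : R) F ((1 + y) `^ (- al)).
  move=> y1; rewrite /F.
  have := is_deriveZ (- (al - 1)^-1) (dP (- (al - 1)) y y1).
  move=> /is_derive_eq; apply; rewrite /GRing.scale/= mulrA mulrNN mulVf ?mul1r.
    by congr (_ `^ _); lra.
  by rewrite gt_eqF// subr_gt0.
rewrite (@ge0_continuous_FTC2y _ _ F 0 0)/=.
- by rewrite ltry.
- by move=> x _; exact: powR_ge0.
- apply/continuous_within_itvcyP; split.
    by move=> x; rewrite in_itv/= andbT => x0; apply: cP; rewrite addr_gt0.
  by apply: cvg_at_right_filter; apply: cP; rewrite addr0.
- rewrite -[X in _ --> X](mulr0 (- (al - 1)^-1)).
  by apply: cvgMl_tmp; apply: cvgy_powRN; rewrite subr_gt0.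
- by move=> x x0; have [] := dF x (addr_gt0 ltr01 x0).
- apply: cvg_at_right_filter; apply/differentiable_continuous/derivable1_diffP.
  by have [] := dF 0 (ltr_pwDl ltr01 (lexx 0)).
- move=> x; rewrite in_itv/= andbT => x0.
  by rewrite derive1E; have [_ ->] := dF x (addr_gt0 ltr01 x0).
Qed.

Lemma integral_lty_of_decay (g : R -> \bar R) (b C1 C2 al : R) :
  0 < b -> 1 < al -> (forall x, 0 <= g x <= C1%:E)%E ->
  (forall x, (b <= `|x|)%R -> g x <= (C2 * `|x| `^ (- al))%:E)%E ->
  (\int[mu]_x g x < +oo)%E.
Proof.
move=> b0 al1 gC1 gC2.
have C10 : 0 <= C1 by case/andP: (gC1 0) => + ?; rewrite -lee_fin => /le_trans; apply.
have al0 : 0 <= al by rewrite ltW// (lt_trans ltr01).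
(* The first summand covers |x| < b, where 1 + |x| <= 1 + b; the second covers |x| >= b, where 1 +
   |x| <= |x| (1 + b)/b. Both bounds thus become multiples of (1 + |x|)^(-al). *)
pose C := C1 * (1 + b) `^ al + `|C2| * ((1 + b) / b) `^ al.
have C0 : 0 <= C by rewrite addr_ge0// mulr_ge0// powR_ge0.
have pos (x : R) : 0 < 1 + `|x| :> R by rewrite (lt_le_trans ltr01)// lerDl.
have gG x : (g x <= (C * (1 + `|x|) `^ (- al))%:E)%E.
  have [xb|xb] := lerP b `|x|.
  - apply: (le_trans (gC2 x xb)); rewrite lee_fin.
    apply: (@le_trans _ _ (`|C2| * ((1 + b) / b) `^ al * (1 + `|x|) `^ (- al))); last first.
      by rewrite ler_wpM2r ?powR_ge0// lerDr mulr_ge0// powR_ge0.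
    rewrite -mulrA; apply: (@le_trans _ _ (`|C2| * `|x| `^ (- al))).
      by rewrite ler_wpM2r ?powR_ge0// ler_norm.
    rewrite ler_wpM2l// !powRN -[leRHS]invrK invfM invrK lef_pV2 ?posrE; last 2 first.
    + by rewrite powR_gt0// (lt_le_trans b0).
    + by rewrite mulr_gt0 ?invr_gt0// powR_gt0// divr_gt0// addr_gt0.
    rewrite mulrC ler_pdivrMr ?powR_gt0 ?divr_gt0 ?addr_gt0//.
    rewrite -powRM ?divr_ge0 ?addr_ge0 ?(ltW b0)//.
    rewrite ge0_ler_powR ?nnegrE ?mulr_ge0 ?invr_ge0 ?addr_ge0 ?(ltW b0)//.
    rewrite mulrA ler_pdivlMr//; nra.
  - have /andP[_ /le_trans] := gC1 x; apply; rewrite lee_fin.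
    apply: (@le_trans _ _ (C1 * (1 + b) `^ al * (1 + `|x|) `^ (- al))); last first.
      by rewrite ler_wpM2r ?powR_ge0// lerDl mulr_ge0// powR_ge0.
    rewrite -mulrA ler_peMr// powRN ler_pdivlMr ?powR_gt0// mul1r.
    by rewrite ge0_ler_powR ?nnegrE ?addr_ge0 ?(ltW b0)// lerD2l ltW.
apply: (@le_lt_trans _ _ (\int[mu]_x (C * (1 + `|x|) `^ (- al))%:E)%E).
  by apply: ge0_le_integralT => // x; case/andP: (gC1 x).
have mf : measurable_fun [set: R] (fun x : R => (1 + `|x|) `^ (- al)).
  apply: (@measurableT_comp _ _ _ _ _ _ (@powR R ^~ (- al))) => //.
  by apply: measurable_funD => //; exact: measurableT_comp.
under eq_integral do rewrite EFinM.
rewrite ge0_integralZl//; last exact/measurable_EFinP.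
by rewrite lte_mul_pinfty ?lee_fin// integral_powRN_lty.
Qed.

End LowerIntegral.

(** * Polynomial approximation *)

Section Taylor.
Context {R : realType}.
Local Notation mu := (@lebesgue_measure R).

(** Induction on the order: the polynomial approximating [g 1] is integrated, and the mean value
    theorem on the difference costs one factor h. The usual factor 1/N! is given up. *)
Lemma taylor_bound (N : nat) (g : nat -> R -> R) (h B : R) : 0 < h ->
  (forall i, (i < N)%N -> forall x : R, is_derive x (1 : R) (g i) (g i.+1 x)) ->
  (forall x, 0 <= x <= h -> `|g N x| <= B) ->
  exists c : nat -> R, forall x, 0 <= x <= h ->
    `|g 0 x - \sum_(i < N) c i * x ^+ i| <= B * h ^+ N.
Proof.
move=> h0; elim: N g => [|N IH] g dg gB.
  by exists (fun=> 0) => x hx; rewrite big_ord0 subr0 expr0 mulr1 gB.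
have [//|//|c hc] := IH (fun i => g i.+1); first by move=> i iN x; exact: dg.
exists (fun i => if i is i'.+1 then c i' / i'.+1%:R else g 0 0) => x /andP[x0 xh].
have B0 : 0 <= B by apply: le_trans (gB 0 _) => //; rewrite lexx ltW.
(* The antiderivative of the inductive polynomial whose value at 0 is [g 0 0], so that [g 0 - T]
   vanishes at 0. *)
pose T (y : R) : R := \sum_(i < N.+1) (if i : nat is i'.+1 then c i' / i'.+1%:R else g 0 0) * y ^+ i.
have dT (y : R) : is_derive y (1 : R) T (\sum_(i < N) c i * y ^+ i).
  have -> : T = cst (g 0 0) + \sum_(i < N) (c i / i.+1%:R) *: (id ^+ i.+1 : R -> R).
    apply/funext => z; rewrite /T big_ord_recl/= expr0 mulr1; congr (_ + _).
    rewrite fct_sumE; apply: eq_bigr => i _.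
    by rewrite /bump/= add1n /GRing.scale/= exprfctE.
  apply: is_derive_eq; rewrite add0r; apply: eq_bigr => i _.
  by rewrite /GRing.scale/= mulr1 mulrA divfK// pnatr_eq0.
pose G := g 0 - T.
have dG (y : R) : is_derive y (1 : R) G (g 1 y - \sum_(i < N) c i * y ^+ i).
  by rewrite /G; apply: is_deriveB; exact: dg.
have cG : {within `[0, x], continuous G}.
  apply: continuous_subspaceT => y; apply/differentiable_continuous/derivable1_diffP.
  by case: (dG y).
have [z + Gz] := MVT_segment x0 (fun y _ => dG y) cG.
rewrite in_itv/= => /andP[z0 zx].
have G0 : G 0 = 0.
  rewrite -[LHS]/(g 0 0 - T 0) /T big_ord_recl/= expr0 mulr1 big1 ?addr0 ?subrr// => i _.
  by rewrite expr0n/= mulr0.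
move: Gz; rewrite G0 !subr0 => Gz.
have -> : g 0 x - \sum_(i < N.+1) (if i : nat is i'.+1 then c i' / i'.+1%:R else g 0 0) * x ^+ i = G x by [].
rewrite Gz normrM (ger0_norm x0) exprSr mulrA ler_pM//.
by apply: hc; rewrite z0 (le_trans zx).
Qed.

End Taylor.

                                        

(** * Bounds on the convolution with dilates, uniform in t *)

Section RealMaximalBounds.
Context {R : realType}.
Local Notation mu := (@lebesgue_measure R).
Variables (a : R -> R) (h A : R).
Hypotheses (h0 : 0 < h) (ma : measurable_fun setT a)
  (a_out : forall x, ~ [set` `]0, h]] x -> a x = 0)
  (aA : forall x, `|a x| <= A).

Let A0 : 0 <= A. Proof. exact: le_trans (normr_ge0 _) (aA 0). Qed.

Lemma is_derive_dilate (f : R -> R) (t x y d : R) :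
  is_derive ((x - y) / t) (1 : R) f d ->
  is_derive y (1 : R) (fun z => f ((x - z) / t)) (- t^-1 * d).
Proof.
move=> df.
have d1 : is_derive y (1 : R) (t^-1 *: (cst x - id) : R -> R) (- t^-1).
  by apply: is_derive_eq; rewrite sub0r /GRing.scale/= mulrN1.
have E (z : R) : (t^-1 *: (cst x - id) : R -> R) z = (x - z) / t.
  by rewrite /GRing.scale/= mulrC.
have df' : is_derive ((t^-1 *: (cst x - id) : R -> R) y) (1 : R) f d by rewrite E.
have := is_derive1_comp df' d1; rewrite mulrC.
by rewrite (_ : f \o _ = (fun z => f ((x - z) / t)))//; apply/funext => z /=; rewrite -E.
Qed.

Lemma continuous_dilate (f : R -> R) (t x : R) : continuous f ->
  continuous (fun y => t^-1 * f ((x - y) / t)).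
Proof.
move=> cf y; apply: cvgMl_tmp.
apply: (@continuous_comp _ _ _ (fun y : R => (x - y) / t) f); last exact: cf.
by apply: cvgMr_tmp; apply: cvgB; [exact: cvg_cst|exact: cvg_id].
Qed.

(** The function f is dominated by the Cauchy kernel K / (1 + u^2). Its dilates all have mass K pi,
    so the bound does not depend on t. *)
Lemma dilate_integral_near (f : R -> R) (K t x : R) : continuous f -> 0 < t ->
  (forall u, (1 + u ^+ 2) * `|f u| <= K) ->
  `|\int[mu]_y (a y * (t^-1 * f ((x - y) / t)))| <= A * (K * pi).
Proof.
move=> cf t0 fK.
have K0 : 0 <= K by apply: le_trans (fK 0); rewrite mulr_ge0// addr_ge0// sqr_ge0.
have cg := continuous_dilate (t := t) (x := x) cf.
have := normr_Rintegral_supp_le ma a_out aA (@subsetT _ _) (continuous_integrable_itvoc h cg).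
move=> /le_trans; apply.
rewrite ler_wpM2l//.
pose H (y : R) : R := K * (t^-1 * (oneDsqr ((x - y) / t))^-1).
have cH : continuous H.
  move=> y; apply: cvgMl_tmp.
  exact: (continuous_dilate (f := fun u => (oneDsqr u)^-1) (@continuous_oneDsqrV R)).
have Igf : mu.-integrable `]0, h] (EFin \o (fun y => `|t^-1 * f ((x - y) / t)|)).
  exact: (@integrable_abse _ _ R mu _ _ (continuous_integrable_itvoc h cg)).
apply: (@le_trans _ _ (\int[mu]_(y in `]0, h]) H y)).
  apply: le_Rintegral => //; first exact: continuous_integrable_itvoc.
  move=> y _; rewrite /H normrM ger0_norm ?invr_ge0 ?(ltW t0)// mulrCA ler_wpM2l ?invr_ge0 ?(ltW t0)//.
  by rewrite ler_pdivlMr ?oneDsqr_gt0// [leLHS]mulrC; exact: fK.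
rewrite Rintegral_itv_obnd_cbnd; last exact: continuous_integrable_itvoc.
(* A primitive of [H]; its increments are at most K pi since [atan] ranges in an interval of length
   pi. *)
pose F (y : R) : R := - K * atan ((x - y) / t).
have dF (y : R) : is_derive y (1 : R) F (H y).
  rewrite /F; have := is_deriveZ (- K) (is_derive_dilate (is_derive1_atan ((x - y) / t))).
  by move=> /is_derive_eq; apply; rewrite /H /oneDsqr /GRing.scale/= mulNr mulNr mulrN opprK.
have cF : continuous F.
  by move=> y; apply/differentiable_continuous/derivable1_diffP; case: (dF y).
rewrite /Rintegral (@continuous_FTC2 _ _ F)//; last 3 first.
- exact: continuous_subspaceT.
- split.
  + by move=> y _; case: (dF y).
  + exact/cvg_at_right_filter/cF.
  + exact/cvg_at_left_filter/cF.
- by move=> y _; rewrite derive1E; have [_ ->] := dF y.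
rewrite /= /F !mulNr opprK addrC -mulrBr ler_wpM2l//.
have := atan_ltpi2 ((x - 0) / t); have := atan_gtNpi2 ((x - h) / t).
lra.
Qed.

Lemma Rintegral_poly0 (N : nat) (c : nat -> R) :
  (forall i, (i < N)%N -> \int[mu]_(y in `]0, h]) (a y * y ^+ i) = 0) ->
  \int[mu]_(y in `]0, h]) (a y * \sum_(i < N) c i * y ^+ i) = 0.
Proof.
have cX i : continuous (fun y : R => y ^+ i) by exact: exprn_continuous.
have I1 (f : R -> R) (cf : continuous f) :=
  integrable_suppM ma aA (continuous_integrable_itvoc h cf).
elim: N => [|N IH] a0.
  under eq_Rintegral do rewrite big_ord0 mulr0.
  by rewrite (Rintegral_cst mu)// mul0r.
under eq_Rintegral do rewrite big_ord_recr/= mulrDr mulrCA.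
have cS : continuous (fun y : R => \sum_(i < N) c i * y ^+ i).
  apply: continuous_big; first exact: add_continuous.
  by move=> i _ y; apply: cvgMl_tmp; exact: cX.
rewrite RintegralD//.
- rewrite IH; last by move=> i iN; rewrite a0// ltnS ltnW.
  by rewrite add0r RintegralZl// ?a0 ?mulr0//; exact: I1.
- exact: I1.
- have := @integrableZl _ _ R mu _ (measurable_itv _) (c N) _ (I1 _ (cX N)).
  exact: eq_integrable.
Qed.

(** The vanishing moments allow subtracting a polynomial in y from the dilate. Its N-th derivative
    in y has modulus t^(-N-1) |f_N((x-y)/t)|, with f_N standing for [f N], and the decay of [f N]
    bounds this by K |x-y|^(-N-1): the powers of t cancel. For |x| >= 2h one has |x-y| >= |x|/2,
    whence the power of 2. *)
Lemma dilate_integral_far (N : nat) (f : nat -> R -> R) (K t x : R) :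
  (forall i (u : R), is_derive u (1 : R) (f i) (f i.+1 u)) -> 0 < t ->
  (forall i, (i < N)%N -> \int[mu]_(y in `]0, h]) (a y * y ^+ i) = 0) ->
  (forall u, `|u| ^+ N.+1 * `|f N u| <= K) -> 2 * h <= `|x| ->
  `|\int[mu]_y (a y * (t^-1 * f 0 ((x - y) / t)))|
    <= A * (K * h ^+ N * h) * 2 ^+ N.+1 * `|x| ^- N.+1.
Proof.
move=> df t0 a0 fK xh.
have K0 : 0 <= K by apply: le_trans (fK 0); rewrite mulr_ge0// exprn_ge0.
have x0 : 0 < `|x| by rewrite (lt_le_trans _ xh)// mulr_gt0.
(* The i-th derivative in y of the dilate; each derivative brings out a factor -1/t. *)
pose g i y := t^-1 * ((- t^-1) ^+ i * f i ((x - y) / t)).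
have dg i (y : R) : is_derive y (1 : R) (g i) (g i.+1 y).
  rewrite /g; have := is_deriveZ t^-1 (is_deriveZ ((- t^-1) ^+ i) (is_derive_dilate (df i ((x - y) / t)))).
  by move=> /is_derive_eq; apply; rewrite /g /GRing.scale/= exprSr !mulrA.
have cf : continuous (f 0).
  by move=> y; apply/differentiable_continuous/derivable1_diffP; case: (df 0 y).
have g0 : (fun y => t^-1 * f 0 ((x - y) / t)) = g 0.
  by apply/funext => y; rewrite /g expr0 mul1r.
have cg : continuous (g 0) by rewrite -g0; exact: continuous_dilate.
pose B := K * 2 ^+ N.+1 * `|x| ^- N.+1.
have gB y : 0 <= y <= h -> `|g N y| <= B.
  move=> /andP[y0 yh].
  have xy : `|x| / 2 <= `|x - y|.
    have := ler_normD (x - y) y; rewrite subrK (ger0_norm y0); lra.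
  have xy0 : 0 < `|x - y| by rewrite (lt_le_trans _ xy)// divr_gt0.
  have -> : `|g N y| = `|x - y| ^- N.+1 * (`|(x - y) / t| ^+ N.+1 * `|f N ((x - y) / t)|).
    rewrite /g !normrM normrX normrN mulrA -exprS (ger0_norm (x := t^-1)) ?invr_ge0 ?(ltW t0)//.
    rewrite exprMn mulrA; congr (_ * _); rewrite mulrA mulVf ?mul1r//.
    by rewrite expf_neq0// gt_eqF.
  rewrite /B -mulrA [leRHS]mulrC ler_pM ?invr_ge0 ?exprn_ge0 ?mulr_ge0 ?exprn_ge0//.
  rewrite -[2 ^+ _]invrK -invfM lef_pV2 ?posrE ?exprn_gt0//; last first.
    by rewrite mulr_gt0 ?invr_gt0 ?exprn_gt0.
  by rewrite -exprVn -exprMn mulrC lerXn2r ?nnegrE ?divr_ge0.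
have [c hc] := taylor_bound h0 (fun i _ => dg i) gB.
pose T (y : R) : R := \sum_(i < N) c i * y ^+ i.
have cX i : continuous (fun y : R => y ^+ i) by exact: exprn_continuous.
have cT : continuous T.
  rewrite /T; apply: continuous_big; first exact: add_continuous.
  by move=> i _ y; apply: cvgMl_tmp; exact: cX.
have aT : \int[mu]_(y in setT) (a y * T y) = 0.
  by rewrite (Rintegral_supp a_out)// Rintegral_poly0.
under eq_Rintegral => y _ do rewrite (congr1 (@^~ y) g0).
have -> : \int[mu]_y (a y * g 0 y) = \int[mu]_y (a y * (g 0 y - T y)).
  under [RHS]eq_Rintegral do rewrite mulrBr.
  rewrite RintegralB//; first by rewrite aT subr0.
  - exact: (integrable_supp ma a_out aA _ _ (continuous_integrable_itvoc h cg)).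
  - exact: (integrable_supp ma a_out aA _ _ (continuous_integrable_itvoc h cT)).
apply: le_trans (normr_Rintegral_supp_le_bound (B := B * h ^+ N) h0 ma a_out aA _ _ _) _ => //.
- by apply: continuous_integrable_itvoc => y; apply: cvgB; [exact: cg|exact: cT].
- by move=> y /andP[y0 yh]; apply: hc; rewrite ltW.
- rewrite le_eqVlt; apply/orP; left; apply/eqP; rewrite /B; ring.
Qed.

End RealMaximalBounds.

(** * Bounded functions with vanishing moments belong to H^p *)

Section HardySpace.
Context {R : realType}.
Local Notation mu := (@lebesgue_measure R).
Implicit Types (f g : R -> R[i]).

Lemma norm_Re_le_normc (z : R[i]) : `|complex.Re z| <= Normc.normc z.
Proof.
by case: z => x y /=; rewrite -sqrtr_sqr ler_wsqrtr// lerDl sqr_ge0.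
Qed.

Lemma norm_Im_le_normc (z : R[i]) : `|complex.Im z| <= Normc.normc z.
Proof.
by case: z => x y /=; rewrite -sqrtr_sqr ler_wsqrtr// lerDr sqr_ge0.
Qed.

Lemma normc_nneg (z : R[i]) : 0 <= Normc.normc z.
Proof. exact: le_trans (normr_ge0 _) (norm_Re_le_normc z). Qed.

Lemma normc_le_Re_Im (z : R[i]) :
  Normc.normc z <= `|complex.Re z| + `|complex.Im z|.
Proof.
case: z => x y /=; rewrite -[leRHS]ger0_norm ?addr_ge0// -[leRHS]sqrtr_sqr.
rewrite ler_wsqrtr// sqrrD !real_normK ?num_real// addrAC lerDl.
by rewrite mulrn_wge0// mulr_ge0.
Qed.

Lemma real_Cn_is_derive (f : R -> R) : (forall n, real_Cn n setT f) ->
  forall i (u : R), is_derive u (1 : R) (derive1n i f) (derive1n i.+1 f u).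
Proof.
move=> sf i u; have [/(_ i (ltnSn i) u I) df _] := sf i.+1.
by rewrite derive1nS derive1E; exact: DeriveDef.
Qed.

Lemma real_Cn_continuous (f : R -> R) : (forall n, real_Cn n setT f) -> continuous f.
Proof. by move=> sf u; have [_ /(_ u I)] := sf 0. Qed.

Lemma seminorm_bound f : (forall i j, (seminorm i j f < +oo)%E) ->
  forall i j, exists S : R, forall u,
    `|u| ^+ i * `|derive1n j (fun y => complex.Re (f y)) u| <= S /\
    `|u| ^+ i * `|derive1n j (fun y => complex.Im (f y)) u| <= S.
Proof.
move=> sf i j.
have ub u : ((`|u| ^+ i * Normc.normc (cderive j f u))%:E <= seminorm i j f)%E.
  by apply: ereal_sup_ubound; exists u.
have fin : (seminorm i j f \is a fin_num)%E.
  rewrite ge0_fin_numE ?sf//; apply: le_trans (ub 0).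
  by rewrite lee_fin mulr_ge0 ?exprn_ge0// normc_nneg.
exists (fine (seminorm i j f)) => u.
have := ub u; rewrite -{1}(fineK fin) lee_fin => H.
split; apply: le_trans H; rewrite ler_wpM2l ?exprn_ge0//.
- exact: (norm_Re_le_normc (cderive j f u)).
- exact: (norm_Im_le_normc (cderive j f u)).
Qed.

Variables (a : R -> R) (h A : R).
Hypotheses (h0 : 0 < h) (ma : measurable_fun setT a)
  (a_out : forall x, ~ [set` `]0, h]] x -> a x = 0)
  (aA : forall x, `|a x| <= A).

Local Notation Fa := (functional_of (fun x => (a x)%:C)).

Lemma functional_ofE f : Fa f =
  (\int[mu]_x (a x * complex.Re (f x))) +i* (\int[mu]_x (a x * complex.Im (f x))).
Proof.
rewrite /functional_of /cintegral; congr (_ +i* _); apply: eq_Rintegral => x _.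
  by case: (f x) => u v /=; rewrite mul0r subr0.
by case: (f x) => u v /=; rewrite mul0r addr0.
Qed.

Lemma smooth_Re f : smooth f -> forall n, real_Cn n setT (fun y => complex.Re (f y)).
Proof. by move=> sf n; have [] := sf n. Qed.

Lemma smooth_Im f : smooth f -> forall n, real_Cn n setT (fun y => complex.Im (f y)).
Proof. by move=> sf n; have [] := sf n. Qed.

Let integrable_aM (f : R -> R) : continuous f ->
  mu.-integrable setT (EFin \o (fun x => a x * f x)).
Proof.
move=> cf.
by apply: (integrable_supp ma a_out aA _ _ (continuous_integrable_itvoc h cf)).
Qed.

Lemma functional_of_tempered : tempered Fa.
Proof.
split.
  move=> [zr zi] f g [sf _] [sg _]; rewrite !functional_ofE.
  have cRf := real_Cn_continuous (smooth_Re sf).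
  have cIf := real_Cn_continuous (smooth_Im sf).
  have cRg := real_Cn_continuous (smooth_Re sg).
  have cIg := real_Cn_continuous (smooth_Im sg).
  have lin (u v : R) (f1 f2 f3 : R -> R) : continuous f1 -> continuous f2 -> continuous f3 ->
      \int[mu]_x (a x * (u * f1 x + v * f2 x + f3 x)) =
      u * (\int[mu]_x (a x * f1 x)) + v * (\int[mu]_x (a x * f2 x)) + \int[mu]_x (a x * f3 x).
    move=> c1 c2 c3.
    have I1 := integrable_aM c1; have I2 := integrable_aM c2; have I3 := integrable_aM c3.
    have Z (w : R) (k : R -> R) : mu.-integrable setT (EFin \o k) ->
        mu.-integrable setT (EFin \o (fun x => w * k x)).
      move=> Ik; have := @integrableZl _ _ R mu _ measurableT w _ Ik.
      exact: eq_integrable.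
    under eq_Rintegral do rewrite !mulrDr (mulrCA _ u) (mulrCA _ v).
    rewrite RintegralD//; last first.
      have := @integrableD _ _ R mu _ measurableT _ _ (Z u _ I1) (Z v _ I2).
      exact: eq_integrable.
    by rewrite RintegralD ?RintegralZl//; exact: Z.
  apply/eqP; rewrite eq_complex /=; apply/andP; split; apply/eqP.
  - rewrite -mulNr -lin//; apply: eq_Rintegral => x _.
    by case: (f x) => ? ?; case: (g x) => ? ? /=; rewrite mulNr.
  - rewrite -lin//; apply: eq_Rintegral => x _.
    by case: (f x) => ? ?; case: (g x) => ? ? /=.
(* The factor 2 accounts for real and imaginary parts, and A h for height times length of the
   support. With N = 0 only the seminorm of index (0, 0), the sup of |f|, remains. *)
exists (2 * (A * h)), 0; move=> f [sf bf].
rewrite !big_ord_recl !big_ord0 !adde0.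
have ub u : ((Normc.normc (f u))%:E <= seminorm 0 0 f)%E.
  apply: (@le_trans _ _ ((`|u| ^+ 0 * Normc.normc (cderive 0 f u))%:E)).
    by rewrite expr0 mul1r /cderive !derive1n0; case: (f u).
  by apply: ereal_sup_ubound; exists u.
have fin : (seminorm 0 0 f \is a fin_num)%E.
  rewrite ge0_fin_numE ?bf//; apply: le_trans (ub 0).
  by rewrite lee_fin normc_nneg.
rewrite -(fineK fin) -EFinM lee_fin functional_ofE.
set S := fine _.
have ubS u : Normc.normc (f u) <= S by rewrite -lee_fin fineK.
have half (k : R -> R) : continuous k -> (forall u, `|k u| <= S) ->
    `|\int[mu]_x (a x * k x)| <= A * h * S.
  move=> ck kS; rewrite -mulrA (mulrC h).
  by apply: (normr_Rintegral_supp_le_bound h0 ma a_out aA _ (continuous_integrable_itvoc h ck)).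
apply: (le_trans (normc_le_Re_Im _)) => /=.
rewrite -mulrA mulr_natl mulr2n lerD// half//.
- exact: real_Cn_continuous (smooth_Re sf).
- by move=> u; apply: le_trans (ubS u); exact: norm_Re_le_normc.
- exact: real_Cn_continuous (smooth_Im sf).
- by move=> u; apply: le_trans (ubS u); exact: norm_Im_le_normc.
Qed.

Lemma functional_of_supported (X : set R) : [set` `]0, h]] `<=` X ->
  dist_supported (closure X) Fa.
Proof.
move=> hX f _ _ f0.
have af x : (a x)%:C * f x = 0.
  case: (pselect ([set` `]0, h]] x)) => hx; last by rewrite a_out// mul0r.
  apply/eqP; rewrite mulf_eq0; apply/orP; right; apply/negPn/negP => fx.
  have : (fsupp f `&` closure X) x by split; apply: subset_closure => //; exact: hX.
  by rewrite f0.
rewrite /functional_of (_ : (fun x => _) = (fun=> 0)); last exact/funext.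
by rewrite /cintegral /= !(Rintegral_cst mu)// !mul0r.
Qed.

Lemma maximal_fun_le (Phi : R -> R[i]) (x : R) (C : \bar R) :
  (forall t, 0 < t ->
    (`|\int[mu]_y (a y * (t^-1 * complex.Re (Phi ((x - y) / t))))|%:E +
     `|\int[mu]_y (a y * (t^-1 * complex.Im (Phi ((x - y) / t))))|%:E <= C)%E) ->
  (maximal_fun Phi Fa x <= C)%E.
Proof.
move=> hC; apply: ge_ereal_sup => _ [t t0 <-]; apply: le_trans (hC t t0).
rewrite functional_ofE -EFinD lee_fin; apply: (le_trans (normc_le_Re_Im _)) => /=.
rewrite lerD// le_eqVlt; apply/orP; left; apply/eqP; congr (`|_|);
  apply: eq_Rintegral => y _; rewrite /dilate; case: (Phi _) => u v /=.
- by rewrite mul0r subr0.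
- by rewrite mul0r addr0.
Qed.

(** The maximal function is bounded, and P+1 vanishing moments make it O(|x|^(-P-2)) at infinity.
    Its p-th power is integrable since (P + 2) p > 1. *)
Lemma functional_of_Hp (p : R) (P : nat) (Phi : R -> R[i]) (X : set R) : 0 < p ->
  p^-1 < P%:R + 2 -> schwartz Phi ->
  (forall i, (i <= P)%N -> \int[mu]_(x in `]0, h]) (a x * x ^+ i) = 0) ->
  [set` `]0, h]] `<=` X ->
  Hp p Phi X Fa.
Proof.
move=> p0 pP [sPhi bPhi] a0 hX.
split; last exact: functional_of_supported.
split; first exact: functional_of_tempered.
have dR := real_Cn_is_derive (smooth_Re sPhi).
have dI := real_Cn_is_derive (smooth_Im sPhi).
have cR := real_Cn_continuous (smooth_Re sPhi).
have cI := real_Cn_continuous (smooth_Im sPhi).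
(* [S0 + S2] bounds (1 + u^2) |Phi(u)| part by part, as the bound near the support requires; [K],
   with power P+2 and derivative P+1, is the far bound for N = P+1. *)
have [S0 hS0] := seminorm_bound bPhi 0 0.
have [S2 hS2] := seminorm_bound bPhi 2 0.
have [K hK] := seminorm_bound bPhi P.+2 P.+1.
pose C1 := A * ((S0 + S2) * pi) *+ 2.
pose C2 := A * (K * h ^+ P.+1 * h) * 2 ^+ P.+2 *+ 2.
have near1 x : (maximal_fun Phi Fa x <= C1%:E)%E.
  apply: maximal_fun_le => t t0; rewrite -EFinD lee_fin /C1 mulr2n lerD//.
  - apply: (dilate_integral_near h0 ma a_out aA x cR t0) => u.
    rewrite mulrDl lerD//; first by have [+ _] := hS0 u; rewrite expr0.
    by have [+ _] := hS2 u; rewrite real_normK ?num_real.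
  - apply: (dilate_integral_near h0 ma a_out aA x cI t0) => u.
    rewrite mulrDl lerD//; first by have [_] := hS0 u; rewrite expr0.
    by have [_] := hS2 u; rewrite real_normK ?num_real.
have far x : 2 * h <= `|x| -> (maximal_fun Phi Fa x <= (C2 * `|x| ^- P.+2)%:E)%E.
  move=> xh; apply: maximal_fun_le => t t0; rewrite -EFinD lee_fin /C2 mulrnAl mulr2n lerD//.
  - apply: (dilate_integral_far h0 ma a_out aA dR t0 _ _ xh) => [i|u].
      by rewrite ltnS; exact: a0.
    by have [] := hK u.
  - apply: (dilate_integral_far h0 ma a_out aA dI t0 _ _ xh) => [i|u].
      by rewrite ltnS; exact: a0.
    by have [] := hK u.
have max0 x : (0 <= maximal_fun Phi Fa x)%E.
  apply: (@le_trans _ _ (Normc.normc (Fa (fun y => dilate Phi 1 (x - y))))%:E).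
    by rewrite lee_fin normc_nneg.
  by apply: ereal_sup_ubound; exists 1 => //=.
have C10 : 0 <= C1 by rewrite -lee_fin; apply: le_trans (near1 0).
have mono (u : \bar R) (v : R) : (0 <= u)%E -> (u <= v%:E)%E -> (u `^ p <= (v `^ p)%:E)%E.
  move=> u0 uv; rewrite -poweR_EFin gt0_ler_poweR ?(ltW p0)//.
    by rewrite in_itv/= u0 leey.
  by rewrite in_itv/= (le_trans u0 uv) leey.
apply: (@integral_lty_of_decay R _ (2 * h) (C1 `^ p) (C2 `^ p) (P.+2%:R * p)).
- by rewrite mulr_gt0.
- by rewrite -ltr_pdivrMr// mul1r -addn2 natrD.
- by move=> x; rewrite poweR_ge0/= mono.
- move=> x xh; have := mono _ _ (max0 x) (far x xh).
  have x0 : 0 < `|x| by rewrite (lt_le_trans _ xh)// mulr_gt0.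
  have C20 : 0 <= C2.
    have := le_trans (max0 x) (far x xh).
    by rewrite lee_fin pmulr_lge0// invr_gt0 exprn_gt0.
  rewrite powRM ?invr_ge0 ?exprn_ge0//.
  by rewrite -[in `|x| ^- _]powR_mulrn// -powRN -powRrM mulNr.
Qed.

End HardySpace.

                                                     

(** * Lower bound for the integral of a step function against a power-like function *)

Section LowerBound.
Context {R : realType}.
Local Notation mu := (@lebesgue_measure R).

Lemma integrable_itvoc_bounded (f : R -> R) (h B : R) :
  measurable_fun [set` `]0, h]] f -> (forall u, 0 < u <= h -> `|f u| <= B) ->
  mu.-integrable `]0, h] (EFin \o f).
Proof.
move=> mf fB.
apply: (@le_integrable _ _ R mu _ _ _ (EFin \o cst B)) => //.
- exact/measurable_EFinP.
- move=> x; rewrite /= in_itv/= lee_fin => /fB fx.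
  by rewrite (le_trans fx)// ler_norm.
- exact/continuous_integrable_itvoc/cst_continuous.
Qed.

Lemma Rintegral_powR_ub (v : R -> R) (be M r : R) : 0 <= be -> 0 <= M -> 0 < r ->
  mu.-integrable `]0, r] (EFin \o v) ->
  (forall u, 0 < u <= r -> v u <= M * u `^ be) ->
  \int[mu]_(u in `]0, r]) v u <= M * r `^ (be + 1).
Proof.
move=> be0 M0 r0 Iv vM.
rewrite powRD ?(gt_eqF r0) ?implybT// powRr1 ?(ltW r0)// mulrA.
have -> : M * r `^ be * r = \int[mu]_(u in `]0, r]) (M * r `^ be).
  rewrite (Rintegral_cst mu)//; congr (_ * _).
  by have /(congr1 fine) := lebesgue_measure_itvoc r0.
apply: le_Rintegral => //.
- exact/continuous_integrable_itvoc/cst_continuous.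
- move=> u; rewrite /= in_itv/= => /[dup] /vM uM /andP[u0 ur].
  by rewrite (le_trans uM)// ler_wpM2l// ge0_ler_powR ?nnegrE ?(ltW u0) ?(ltW r0).
Qed.

(** Only ]h/2, h] is kept, where u^be >= (h/2)^be. The loss is a constant factor; the power of h is
    the right one. *)
Lemma Rintegral_powR_lb (v : R -> R) (be m h : R) : 0 <= be -> 0 <= m -> 0 < h ->
  mu.-integrable `]0, h] (EFin \o v) ->
  (forall u, 0 < u <= h -> m * u `^ be <= v u) ->
  m * (h / 2) `^ (be + 1) <= \int[mu]_(u in `]0, h]) v u.
Proof.
move=> be0 m0 h0 Iv vm.
have hh : 0 < h / 2 by rewrite divr_gt0.
have hle : h / 2 <= h by rewrite ler_pdivrMr//; lra.
rewrite powRD ?(gt_eqF hh) ?implybT// powRr1 ?(ltW hh)// mulrA.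
have -> : h / 2 = h - h / 2 by lra.
set w := m * _.
have -> : w * (h - h / 2) = \int[mu]_(u in `]0, h]) (w * \1_(`](h / 2), h]) u).
  rewrite RintegralZl//; last first.
    apply: (integrable_itvoc_bounded (B := 1)); first exact: measurable_indic.
    by move=> u _; rewrite indicE; case: (_ \in _); rewrite ?normr1 ?normr0.
  congr (_ * _).
  have -> : \int[mu]_(u in `]0, h]) \1_(`](h / 2), h]) u = fine (\int[mu]_(u in `]0%R, h]) (\1_(`](h / 2), h]) u)%:E)%E by [].
  rewrite integral_indic// setIidl; last first.
    by move=> u /=; rewrite !in_itv/= => /andP[uh ->]; rewrite (lt_trans hh).
  have : lebesgue_measure [set` `](h / 2), h]] = (h - h / 2)%:E :> \bar R.
    by rewrite lebesgue_measure_itv/= lte_fin ltr_pdivrMr// ifT//; lra.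
  by move=> /(congr1 fine).
apply: le_Rintegral => //.
- apply: (integrable_itvoc_bounded (B := `|w|)).
    by apply: measurable_funM => //; exact: measurable_indic.
  move=> u _; rewrite normrM indicE.
  by case: (_ \in _); rewrite ?normr1 ?normr0 ?mulr1 ?mulr0.
- move=> u; rewrite /= in_itv/= => /[dup] /vm um /andP[u0 uh].
  have v0 : 0 <= v u by apply: le_trans um; rewrite mulr_ge0// powR_ge0.
  rewrite indicE; case: (boolP (u \in _)) => [/set_mem|_]; last by rewrite mulr0.
  rewrite /= in_itv/= mulr1 => /andP[hu _].
  apply: le_trans um; rewrite /w ler_wpM2l// ge0_ler_powR ?nnegrE ?(ltW u0)//.
  - by lra.
  - by lra.
Qed.

(** The full interval, j = 0, gives the main term; the upper bound on v makes each other step at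
    most M w h^(be+1) |c_j| e^(j(be+1)), and these add up to at most the fraction [de]. In use, v is
    |[phi k]| and w is (k+1)^tau. *)
Lemma step_integral_lb (n : nat) (c : nat -> R) (e de be m M w h : R) (v : R -> R) :
  0 < e < 1 -> c 0 = 1 -> 0 <= be -> 0 < m <= M -> 0 <= w -> 0 < h ->
  \sum_(j < n) `|c j.+1| * (e ^+ j.+1) `^ (be + 1) <= de ->
  mu.-integrable `]0, h] (EFin \o v) ->
  (forall u, 0 < u <= h -> m * (w * u `^ be) <= v u <= M * (w * u `^ be)) ->
  w * h `^ (be + 1) * (m * 2^-1 `^ (be + 1) - M * de) <=
  \sum_(j < n.+1) c j * \int[mu]_(u in `]0, h * e ^+ j]) v u.
Proof.
move=> /andP[e0 e1] c0 be0 /andP[m0 mM] w0 h0 sde Iv hv.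
have M0 : 0 < M by rewrite (lt_le_trans m0).
rewrite big_ord_recl c0 mul1r expr0 mulr1 mulrBr lerD//.
  have -> : w * h `^ (be + 1) * (m * 2^-1 `^ (be + 1)) = (m * w) * (h / 2) `^ (be + 1).
    by rewrite powRM ?invr_ge0 ?(ltW h0)//; ring.
  apply: Rintegral_powR_lb => //; first by rewrite mulr_ge0// ltW.
  by move=> u /hv /andP[+ _]; rewrite mulrA.
rewrite lerNl -sumrN.
have -> : w * h `^ (be + 1) * (M * de) = (M * w * h `^ (be + 1)) * de by ring.
apply: (@le_trans _ _ (M * w * h `^ (be + 1) *
    \sum_(j < n) `|c j.+1| * (e ^+ j.+1) `^ (be + 1))); last first.
  by rewrite ler_wpM2l// !mulr_ge0 ?powR_ge0 ?(ltW M0).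
rewrite mulr_sumr; apply: ler_sum => j _.
rewrite /bump/= ?add1n.
have ej0 : 0 < e ^+ j.+1 by rewrite exprn_gt0.
have rh : h * e ^+ j.+1 <= h by rewrite ler_piMr ?(ltW h0)// exprn_ile1 ?(ltW e0) ?(ltW e1).
set Iv' := \int[mu]_(u in _) v u.
have I0 : 0 <= Iv'.
  apply: Rintegral_ge0 => u; rewrite /= in_itv/= => /andP[u0 ur].
  have /andP[+ _] : m * (w * u `^ be) <= v u <= M * (w * u `^ be).
    by apply: hv; rewrite u0 (le_trans ur).
  by apply: le_trans; rewrite !mulr_ge0 ?powR_ge0 ?(ltW m0).
have IM : Iv' <= M * w * (h * e ^+ j.+1) `^ (be + 1).
  apply: Rintegral_powR_ub; rewrite ?mulr_ge0 ?mulr_gt0 ?(ltW M0)//.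
    apply: integrableS Iv => // u /=; rewrite !in_itv/= => /andP[-> ur].
    exact: le_trans rh.
  move=> u /andP[u0 ur]; rewrite -mulrA.
  by have /andP[_] := hv u (introT andP (conj u0 (le_trans ur rh))).
apply: (@le_trans _ _ (`|c j.+1| * Iv')).
  by rewrite -mulNr ler_wpM2r// -normrN ler_norm.
apply: (le_trans (ler_wpM2l (normr_ge0 _) IM)).
rewrite powRM ?(ltW h0) ?(ltW ej0)// le_eqVlt; apply/orP; left; apply/eqP; ring.
Qed.

End LowerBound.

(** * Atoms with large pairings *)

Section TestFunctions.
Context {R : realType}.
Local Notation mu := (@lebesgue_measure R).

(** Comparability with 0 in [R[i]] forces a zero imaginary part, so the sign condition also says
    that f is real on D. *)
Lemma real_sign (f : R -> R[i]) (D : set R) :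
  (forall u, D u -> 0 <= f u) \/ (forall u, D u -> f u <= 0) ->
  exists2 sg : R, `|sg| = 1 & forall u, D u -> Normc.normc (f u) = sg * complex.Re (f u).
Proof.
have norm_real (z : R[i]) : complex.Im z = 0 -> Normc.normc z = `|complex.Re z|.
  by case: z => x y /= ->; rewrite expr0n addr0 sqrtr_sqr.
case=> H; [exists 1|exists (-1)]; rewrite ?normrN ?normr1// => u /H;
  rewrite lecE /= => /andP[/eqP Im0 Re0].
- by rewrite norm_real ?mul1r ?ger0_norm// -Im0.
- by rewrite norm_real ?mulN1r ?ler0_norm.
Qed.

(** The modulus of the pairing dominates its real part, which conjugation leaves unchanged; up to
    the global sign [sg] that part is the pairing with |f|. *)
Lemma normc_inner_step_ge (n : nat) (c r : nat -> R) (k0 h : R) (X : set R)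
    (f : R -> R[i]) (sg : R) : measurable X -> [set` `]0, h]] `<=` X ->
  (forall j, (j < n)%N -> r j <= h) -> 0 <= k0 -> `|sg| = 1 ->
  (forall u, 0 < u <= h -> Normc.normc (f u) = sg * complex.Re (f u)) ->
  mu.-integrable `]0, h] (EFin \o (fun u => complex.Re (f u))) ->
  k0 * (\sum_(j < n) c j * \int[mu]_(u in `]0, r j]) Normc.normc (f u)) <=
  Normc.normc (inner X (fun x => (k0 * step n c r x)%:C) f).
Proof.
move=> mX hX rh k00 sg1 fsg If.
apply: (le_trans _ (norm_Re_le_normc _)).
have [Is Es] := Rintegral_step c mX hX rh If.
have -> : complex.Re (inner X (fun x => (k0 * step n c r x)%:C) f) =
    k0 * \sum_(j < n) c j * \int[mu]_(u in `]0, r j]) complex.Re (f u).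
  rewrite -Es -RintegralZl//; apply: eq_Rintegral => x _.
  by case: (f x) => u v /=; rewrite mul0r subr0 mulrA.
rewrite normrM (ger0_norm k00) ler_wpM2l//.
rewrite -[leRHS]mul1r -sg1 -normrM; apply: (le_trans _ (ler_norm _)).
rewrite mulr_sumr le_eqVlt; apply/orP; left; apply/eqP.
apply: eq_bigr => j _; rewrite mulrCA; congr (_ * _); rewrite -RintegralZl//.
  apply: eq_Rintegral => u /set_mem; rewrite /= in_itv/= => /andP[u0 ur].
  by rewrite fsg// u0 (le_trans ur)// rh.
by apply: integrableS If => // u /=; rewrite !in_itv/= => /andP[-> ur]; rewrite (le_trans ur)// rh.
Qed.

(** The order of the quantifiers matters: [ka] is independent of h, and F is chosen before f and w,
    so that one atom serves all [phi k] with k <= K. *)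
Lemma large_pairing_atoms (p : R) (P : nat) (q : \bar R) (Phi : R -> R[i])
    (X : set R) (be m M : R) :
  0 < p -> p <= 1 -> P = Num.truncn (p^-1 - 1) ->
  schwartz Phi -> (1 <= q)%E -> measurable X -> p^-1 - 1 < be -> 0 < m <= M ->
  exists2 ka : R, 0 < ka & forall h : R, 0 < h -> [set` `]0, h]] `<=` X ->
    exists F : (R -> R[i]) -> R[i], [/\ Hp p Phi X F,
      (Hp_norm p q X F <= 1)%E &
      forall f, exists2 z, is_Hp_pairing p q X F f z &
        forall w, cmeasurable X f -> 0 <= w ->
        (forall u, 0 < u <= h ->
          m * (w * u `^ be) <= Normc.normc (f u) <= M * (w * u `^ be)) ->
        (forall u, 0 < u <= h -> 0 <= f u) \/ (forall u, 0 < u <= h -> f u <= 0) ->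
        ka * h `^ (be + 1 - p^-1) * w <= Normc.normc z].
Proof.
move=> p0 p1 PE sPhi q1 mX be1 /andP[m0 mM].
have pi1 : 0 <= p^-1 - 1 by rewrite subr_ge0 -invr1 lef_pV2 ?posrE.
have /andP[Pp pP] : P%:R <= p^-1 - 1 < P.+1%:R by rewrite PE truncn_itv.
have pP2 : p^-1 < P%:R + 2 by move: pP; rewrite -natr1; lra.
have M0 : 0 < M by rewrite (lt_le_trans m0).
have be0 : 0 <= be.
  by rewrite ltW// (le_lt_trans pi1).
(* Chosen so that the steps j >= 1 cost at most half of the main term m 2^(-be-1). *)
pose de := m * 2^-1 `^ (be + 1) / (2 * M).
have de0 : 0 < de by rewrite divr_gt0 ?mulr_gt0 ?powR_gt0 ?invr_gt0.
(* Moments of orders 0, ..., P are power sums of exponents 1, ..., P+1. The condition P + 1 < be + 1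
   follows from P <= 1/p - 1 < be. *)
have [] := @vanishing_step_coefs R P.+1 be de _ de0; first by rewrite -natr1 ltrD2r (le_lt_trans Pp).
move=> e [c [e01 c0 mom small]].
have /andP[e0 e1] := e01.
pose B := \sum_(j < P.+2) `|c j|.
have B0 : 0 < B.
  by rewrite /B big_ord_recl c0 normr1 ltr_wpDr ?sumr_ge0.
pose ka := (m * 2^-1 `^ (be + 1) - M * de) / B.
have ka0 : 0 < ka.
  rewrite divr_gt0//.
  have -> : M * de = m * 2^-1 `^ (be + 1) / 2 by rewrite /de; field; rewrite gt_eqF.
  have : 0 < m * 2^-1 `^ (be + 1) by rewrite mulr_gt0 ?powR_gt0 ?invr_gt0.
  lra.
exists ka => // h h0 hX.
pose r (j : nat) := h * e ^+ j.
have r0 j : 0 < r j <= h.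
  rewrite mulr_gt0 ?exprn_gt0//= ler_piMr ?(ltW h0)//.
  by rewrite exprn_ile1 ?ltW.
have rh j : (j < P.+2)%N -> r j <= h by move=> _; case/andP: (r0 j).
(* Since [B] bounds the step function, this scaling gives the sup bound h^(-1/p) of an atom. *)
pose k0 := h `^ (- p^-1) / B.
have k00 : 0 < k0 by rewrite divr_gt0 ?powR_gt0.
pose a x := k0 * step P.+2 c r x.
have ma : measurable_fun setT a.
  by apply: measurable_funM => //; exact: measurable_step.
have a_out x : ~ [set` `]0, h]] x -> a x = 0.
  by move=> hx; rewrite /a (@step_out _ _ _ _ h) ?mulr0// => j _; case/andP: (r0 j).
have aA x : `|a x| <= h `^ (- p^-1).
  rewrite normrM (ger0_norm (ltW k00)) /k0 mulrAC ler_pdivrMr//.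
  by rewrite ler_wpM2l ?powR_ge0//; exact: norm_step_le.
have a_mom i : (i <= P)%N -> \int[mu]_(x in `]0, h]) (a x * x ^+ i) = 0.
  move=> iP; under eq_Rintegral do rewrite /a -mulrA.
  rewrite RintegralZl//.
    rewrite (@step_moment _ _ _ _ _ h) ?mulr0//.
    under eq_bigr do rewrite exprMn mulrCA.
    by rewrite -mulr_sumr mom ?mulr0.
  have cX : continuous (fun x : R => x ^+ i) by exact: exprn_continuous.
  by have [] := Rintegral_step c (measurable_itv _) (@subset_refl _ _) rh
    (continuous_integrable_itvoc h cX).
have ata : atom p q (fun x => (a x)%:C).
  by apply: (@bounded_atom _ _ _ _ h) => // i; rewrite -PE; exact: a_mom.
have aX x : ~ X x -> (a x)%:C = 0.
  by move=> nX; rewrite a_out// => /hX.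
exists (functional_of (fun x => (a x)%:C)); split.
- exact: (functional_of_Hp h0 ma a_out aA p0 pP2 sPhi a_mom hX).
- exact: Hp_norm_atom_le1.
move=> f; exists (inner X (fun x => (a x)%:C) f); first exact: Hp_pairing_atom.
move=> w [mRe _] w0 fb /real_sign[sg sg1 fsg].
have bnd u : 0 < u <= h -> Normc.normc (f u) <= M * (w * h `^ be).
  move=> uh; have /andP[_ /le_trans] := fb u uh; apply.
  have /andP[u0 uh'] := uh.
  by rewrite !ler_wpM2l ?(ltW M0)// ge0_ler_powR ?nnegrE ?(ltW u0) ?(ltW h0).
have mReh : measurable_fun [set` `]0, h]] (fun u => complex.Re (f u)) by exact: measurable_funS mRe.
have If : mu.-integrable `]0, h] (EFin \o (fun u => complex.Re (f u))).
  apply: (integrable_itvoc_bounded (B := M * (w * h `^ be))) => // u uh.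
  exact: le_trans (norm_Re_le_normc _) (bnd u uh).
have In : mu.-integrable `]0, h] (EFin \o (fun u => Normc.normc (f u))).
  have := @integrableZl _ _ R mu _ (measurable_itv _) sg _ If.
  by apply: eq_integrable => // u /set_mem; rewrite /= in_itv/= => uh; rewrite -EFinM -fsg.
apply: le_trans (normc_inner_step_ge c mX hX rh (ltW k00) sg1 fsg If).
have := step_integral_lb e01 c0 be0 (introT andP (conj m0 mM)) w0 h0 small In fb.
move=> /(ler_wpM2l (ltW k00)); apply: le_trans.
rewrite le_eqVlt; apply/orP; left; apply/eqP.
rewrite powRD ?(gt_eqF h0) ?implybT// /ka /k0; ring.
Qed.

End TestFunctions.

(** * Summation over a dyadic block and conclusion *)

(** The loss 2^(-|e|) makes the bound valid for either sign of e, which is needed because the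
    exponent in the final sum has no definite sign. *)
Lemma powR_doubling_ge (R : realType) (e x y : R) : 0 < x -> x <= y <= 2 * x ->
  x `^ e * 2 `^ (- `|e|) <= y `^ e.
Proof.
move=> x0 /andP[xy yx]; have y0 : 0 < y by rewrite (lt_le_trans x0).
have yE : y = x * (y / x) by field; rewrite gt_eqF.
have yx1 : 1 <= y / x by rewrite ler_pdivlMr// mul1r.
rewrite [in leRHS]yE powRM ?divr_ge0 ?(ltW x0) ?(ltW y0)//.
rewrite ler_wpM2l ?powR_ge0//.
apply: (@le_trans _ _ ((y / x) `^ (- `|e|))); last first.
  by rewrite ler_powR// lerNl -normrN ler_norm.
rewrite !powRN lef_pV2 ?posrE ?powR_gt0 ?divr_gt0//.
by rewrite ge0_ler_powR ?nnegrE ?divr_ge0 ?(ltW x0) ?(ltW y0)// ler_pdivrMr.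
Qed.

Lemma powR_unbounded (R : realType) (k eps C : R) : 0 < k -> 0 < eps ->
  exists2 n : nat, (0 < n)%N & C < k * n%:R `^ eps.
Proof.
move=> k0 e0; pose D := `|C| / k + 1.
have D0 : 0 < D by rewrite ltr_wpDl// divr_ge0// ltW.
pose n := (Num.truncn (D `^ eps^-1)).+1; exists n => //.
have Dn : D `^ eps^-1 <= n%:R by rewrite ltW// truncnS_gt.
have -> : C < k * n%:R `^ eps = (C < n%:R `^ eps * k) by rewrite mulrC.
rewrite -ltr_pdivrMr//.
apply: (@lt_le_trans _ _ D).
  by rewrite /D ltr_pwDr// ler_pM2r ?invr_gt0// ler_norm.
rewrite -[leLHS]powRr1 ?(ltW D0)// -[X in _ `^ X](mulVf (lt0r_neq0 e0)) powRrM.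
by rewrite ge0_ler_powR ?nnegrE ?powR_ge0 ?(ltW e0).
Qed.

Theorem proposition2p5 (R : realType)
  (p s : R) (hp0 : 0 < p) (hp1 : p <= 1) (hps : p <= s) (hs2 : s <= 2)
  (P : nat) (hP : P = Num.truncn (p^-1 - 1))
                                                                           
  (Phi : R -> R[i]) (hPhi : schwartz Phi) (hPhi0 : cintegral setT Phi != 0)
  (q : \bar R) (hq1 : (1 <= q)%E) (hpq : (p%:E < q)%E)
  (X : set R) (hXopen : open X) (hXitv : is_interval X)
  (c : R) (hc : 0 < c) (hcX : [set` `]0, c[] `<=` X)
  (phi : nat -> R -> R[i]) (hphi : orthonormal_basis X phi)
  (hphiLip : forall k, Lip_on (p^-1 - 1) X (phi k))
  (kernel : R -> R -> R -> R[i])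
  (hkernel : forall r : R, 0 < r < 1 -> is_kernel_of X phi r (kernel r))
  (hkernelC : forall r : R, 0 < r < 1 ->
     forall y, X y -> Cn P X (fun x => kernel r x y))
  (gamma : R) (hgamma : 0 < gamma)
  (Delta : {fset R})
  (hDelta : forall d, d \in Delta -> 0 < d /\ p^-1 - 1 - P%:R < d)
  (hTaylor : forall k : nat, (k <= P)%N -> exists Ck : R,
     forall r x x' : R, 0 < r < 1 -> X x -> X x' -> `|x - x'| <= 1 / 2 ->
     (L2norm X (fun y => kernel r x y -
        \sum_(0 <= i < k.+1) cderive i (fun x => kernel r x y) x'
           * ((x - x') ^+ i / i`!%:R)%:C)%R
      <= (Ck * \sum_(d <- Delta)
            (1 - r) `^ (- ((1 + 2 * k%:R + 2 * d) * gamma))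
            * `|x - x'| `^ (k%:R + d))%:E)%E)
  (tau : R) (htau : (4 * gamma - 2 * p * gamma - p) / (2 * p) < tau)
  (m M : R) (hm : 0 < m) (hmM : m <= M)
  (hphiBounds : forall (K k : nat) (u : R), (1 <= K)%N -> (k <= K)%N ->
     0 < u < c * K%:R `^ (- (2 * gamma)) ->
     let b := k.+1%:R `^ tau
              * u `^ ((1 + 2 * tau - 2 * gamma) / (4 * gamma)) in
     m * b <= Normc.normc (phi k u) <= M * b)
                                                                         
  (hphiSign : forall K k : nat, (1 <= K)%N -> (k <= K)%N ->
     (forall u : R, 0 < u < c * K%:R `^ (- (2 * gamma)) -> 0 <= phi k u) \/
     (forall u : R, 0 < u < c * K%:R `^ (- (2 * gamma)) -> phi k u <= 0)) :
  let E := (2 - p) * s * gamma / p + (2 - s) / 2 in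
  forall eps : R, 0 < eps ->
  ~ exists C : R, forall (F : (R -> R[i]) -> R[i]) (z : nat -> R[i]),
      Hp p Phi X F ->
      (forall k, is_Hp_pairing p q X F (phi k) (z k)) ->
      (\sum_(0 <= k <oo)
          (Normc.normc (z k) `^ s * k.+1%:R `^ (- (E - eps)))%:E
        <= C%:E * Hp_norm p q X F `^ s)%E.
Proof.
move=> E eps eps0 [C hC].
pose be := (1 + 2 * tau - 2 * gamma) / (4 * gamma).
(* Solved for tau, this is exactly the hypothesis [htau]. *)
have be1 : p^-1 - 1 < be.
  rewrite /be ltr_pdivlMr ?mulr_gt0//.
  have := htau; rewrite ltr_pdivrMr ?mulr_gt0// => htau'.
  have -> : (p^-1 - 1) * (4 * gamma) = (4 * gamma - 2 * p * gamma - p) / p + 1 - 2 * gamma.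
    by field; rewrite gt_eqF.
  rewrite -ltrBrDr; have -> : 1 + 2 * tau - 2 * gamma - - (2 * gamma) = 1 + 2 * tau by ring.
  by rewrite addrC ltrD2l ltr_pdivrMr//; lra.
have mX : measurable X by exact: open_measurable.
have s0 : 0 < s by rewrite (lt_le_trans hp0).
have [ka ka0 test] := large_pairing_atoms hp0 hp1 hP hPhi hq1 mX be1
  (introT andP (conj hm hmM)).
pose rho := be + 1 - p^-1.
pose e := tau * s + eps - E.
(* The exponent count: 1 for the number of terms in the block, -2 gamma rho s from h^(rho s), and e
   from the powers of k+1. The value of E is the one for which these leave eps. *)
have expo : 1 - 2 * gamma * rho * s + e = eps.
  by rewrite /rho /e /be /E; field; rewrite !gt_eqF.
pose k1 := (ka * (c / 2) `^ rho) `^ s * 2 `^ (- (2 * gamma * rho * s)) * 2 `^ (- `|e|).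
have k10 : 0 < k1 by rewrite !mulr_gt0 ?powR_gt0 ?mulr_gt0 ?powR_gt0 ?divr_gt0.
have [n n0] := powR_unbounded `|C| k10 eps0.
apply/negP; rewrite -leNgt.
have n0' : 0 < n%:R :> R by rewrite ltr0n.
pose K := (2 * n)%N.
have K1 : (1 <= K)%N by rewrite muln_gt0.
have KE : K%:R = 2 * n%:R :> R by rewrite natrM.
have K0 : 0 < K%:R :> R by rewrite ltr0n.
(* The factor 1/2 puts the closed endpoint h strictly inside the range where the bounds on [phi k]
   hold. *)
pose h := c / 2 * K%:R `^ (- (2 * gamma)).
have h0 : 0 < h by rewrite mulr_gt0 ?powR_gt0 ?divr_gt0.
have hlt : h < c * K%:R `^ (- (2 * gamma)).
  by rewrite /h ltr_pM2r ?powR_gt0// ltr_pdivrMr//; lra.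
have hc' : c * K%:R `^ (- (2 * gamma)) <= c.
  rewrite ler_piMr ?(ltW hc)// powRN invf_le1 ?powR_gt0//.
  by rewrite -[leLHS](powRr0 K%:R) ler_powR ?ler1n// mulr_ge0// ltW.
have hX : [set` `]0, h]] `<=` X.
  move=> u; rewrite /= in_itv/= => /andP[u0 uh]; apply: hcX.
  by rewrite /= in_itv/= u0 (le_lt_trans uh)// (lt_le_trans hlt).
have [F [HF nF]] := test h h0 hX.
move=> /(_ (phi _)) pair.
(* Pairings are chosen for all k, as [hC] demands; the lower bound is claimed only for k <= K. *)
have [z hz] : exists z : nat -> R[i], forall k, is_Hp_pairing p q X F (phi k) (z k) /\
    ((k <= K)%N -> ka * h `^ rho * k.+1%:R `^ tau <= Normc.normc (z k)).
  suff : forall k, exists zk, is_Hp_pairing p q X F (phi k) zk /\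
    ((k <= K)%N -> ka * h `^ rho * k.+1%:R `^ tau <= Normc.normc zk) by move=> /choice[z hz]; exists z.
  move=> k; have [zk hzk lb] := pair k; exists zk; split=> // kK; apply: lb.
  - by have [/(_ k) [+ _] _ _] := hphi.
  - exact: powR_ge0.
  - move=> u /andP[u0 uh]; apply: (hphiBounds K k u K1 kK).
    by rewrite u0 (le_lt_trans uh).
  - have [H|H] := hphiSign K k K1 kK; [left|right] => u /andP[u0 uh]; apply: H;
    by rewrite u0 (le_lt_trans uh).
have := hC F z HF (fun k => (hz k).1).
set S := (X in (X <= _)%E) => ub.
(* The sign of C is not known, so |C| replaces it before the norm is bounded by 1. *)
have {}ub : (S <= `|C|%:E)%E.
  apply: (le_trans ub).
  have N0 : (0 <= Hp_norm p q X F `^ s)%E by exact: poweR_ge0.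
  apply: (@le_trans _ _ (`|C|%:E * Hp_norm p q X F `^ s)%E).
    by rewrite lee_wpmul2r// lee_fin ler_norm.
  rewrite -[leRHS]mule1 lee_wpmul2l ?lee_fin// -(poweR1r s).
  have H0 : (0 <= Hp_norm p q X F)%E.
    by apply: le_ereal_inf_tmp => _ [lam [a [_ ->]]]; exact: poweR_ge0.
  by rewrite gt0_ler_poweR ?(ltW s0)// in_itv/= ?H0 ?leey ?lee01.
rewrite -lee_fin; apply: le_trans ub.
have t0 k : (0 <= (Normc.normc (z k) `^ s * k.+1%:R `^ (- (E - eps)))%:E)%E.
  by rewrite lee_fin mulr_ge0 ?powR_ge0.
apply: le_trans (nneseries_lim_ge K _) => //.
rewrite sumEFin lee_fin.
(* The terms k < n are dropped: on n <= k < 2n all k+1 are comparable to n. *)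
rewrite (big_cat_nat _ (n := n))//=; last by rewrite /K mul2n -addnn leq_addr.
apply: ler_wpDl; first by rewrite sumr_ge0// => i _; rewrite -lee_fin.
have -> : k1 * n%:R `^ eps = \sum_(n <= k < K) (k1 * n%:R `^ (eps - 1)).
  rewrite sumr_const_nat /K mul2n -addnn addnK -[RHS]mulr_natr -[RHS]mulrA; congr (_ * _).
  rewrite -{3}(powRr1 (ltW n0')) -powRD ?subrK//.
  by rewrite (gt_eqF n0') implybT.
apply: ler_sum_nat => k /andP[nk kK].
have lb := (hz k).2 (ltnW kK).
have k0 : 0 < k.+1%:R :> R by rewrite ltr0n.
apply: (@le_trans _ _ ((ka * h `^ rho * k.+1%:R `^ tau) `^ s * k.+1%:R `^ (- (E - eps)))); last first.
  rewrite ler_wpM2r ?powR_ge0// ge0_ler_powR ?nnegrE ?(ltW s0) ?normc_nneg//.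
  by rewrite !mulr_ge0 ?powR_ge0 ?(ltW ka0).
rewrite powRM ?powR_ge0 ?mulr_ge0 ?powR_ge0 ?(ltW ka0)// -powRrM -[leRHS]mulrA -powRD; last first.
  by rewrite (gt_eqF k0) implybT.
have -> : tau * s - (E - eps) = e by rewrite /e; ring.
have kn : n%:R `^ e * 2 `^ (- `|e|) <= k.+1%:R `^ e.
  by apply: powR_doubling_ge => //; rewrite ler_nat (leq_trans nk)//= -KE ler_nat.
apply: (le_trans _ (ler_wpM2l (powR_ge0 _ _) kn)).
(* Expressing h through K = 2n turns the power of h into n^(-2 gamma rho), the constants being those
   gathered in [k1]. *)
have -> : ka * h `^ rho = ka * (c / 2) `^ rho * (2 * n%:R) `^ (- (2 * gamma * rho)).
  by rewrite /h powRM ?powR_ge0 ?divr_ge0 ?(ltW hc)// -powRrM KE mulNr mulrA.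
rewrite [in leRHS]powRM ?mulr_ge0 ?powR_ge0 ?(ltW ka0)// -[in leRHS]powRrM.
rewrite [in leRHS](powRM (- (2 * gamma * rho) * s)) ?ler0n// mulNr.
have -> : eps - 1 = - (2 * gamma * rho * s) + e by rewrite -expo; ring.
rewrite powRD; last by rewrite (gt_eqF n0') implybT.
rewrite /k1 le_eqVlt; apply/orP; left; apply/eqP; ring.
Qed.
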